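(* For any path $s\mapsto\mathscr{A}(s)$, $s\in[0,1]$, in the space $\mathscr{G}$ of all linear gauge conditions, regarded as a succession of infinitesimal changes of gauge condition, let $\Psi_0\mapsto\Psi_1$ be the transformation obtained by carrying out successively along the path the infinitesimal gauge transformations of wave functions; that is, $\Psi_1=\Psi(1)$ where $\Psi(0)=\Psi_0$ and $$\frac{d}{ds}\Psi(s)^{(m,n)}=-\frac1{e_x}\sum_{k=1}^n\partial_{y_k,\mu_k}\Theta_k(s)\Psi(s)^{(m,n)}+i\sqrt{n+1}\sum_{j=1}^m\bigl(\Theta_{n+1}(s)\Psi(s)^{(m,n+1)}\bigr)(x_1...x_m,y_1...y_n,x_j).$$ Here $\Theta(s)$ is a linear operator from $\mathscr{A}(s)$ to complex functions on $\mathbb{M}^4$ that generates the change of gauge condition at $\mathscr{A}(s)$ in the direction of the path, and is determined up to addition of a linear map $C:\mathscr{A}(s)\to\mathbb{C}$. Then, for a suitable choice of the additive freedom $C$ in the operators $\Theta$, the transformation $\Psi_0\mapsto\Psi_1$ depends only on the end points $\mathscr{A}(0)$ and $\mathscr{A}(1)$ and not on the path between them.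
   Context: Conventions. $\mathbb{M}^4$ is Minkowski space-time with metric $\mathrm{diag}(1,-1,-1,-1)$; $e_x\ne0$ is a real constant (electron charge). Wave function. A configuration $(x_1...x_m,y_1...y_n)$ of space-time points ($m$ electrons, $n$ photons) is spacelike if any two of the points are spacelike separated or equal. $\Psi$ is a function on the set $\mathscr{S}_{xy}$ of all spacelike configurations (all $m,n\ge0$) whose restriction $\Psi^{(m,n)}$ to configurations of $m$ electrons and $n$ photons has complex components $\Psi^{(m,n)}_{s_1...s_m,\mu_1...\mu_n}(x_1...x_m,y_1...y_n)$, $s_j\in\{1,2,3,4\}$, $\mu_k\in\{0,1,2,3\}$, antisymmetric under permutations of the $x_j$ together with the $s_j$ and symmetric under permutations of the $y_k$ together with the $\mu_k$. Linear gauge condition. Let $(dA)_{\mu\nu}=\partial_\mu A_\nu-\partial_\nu A_\mu$ and let $\mathscr{F}$ be a fixed suitable function space of complex field tensors on $\mathbb{M}^4$. A linear gauge condition is a complex linear subspace $\mathscr{A}$ of the space of complex vector fields $A_\mu$ on $\mathbb{M}^4$ such that $d:\mathscr{A}\to\mathscr{F}$ is bijective. $\mathscr{G}$ denotes the set of all linear gauge conditions. $\Psi$ obeys the gauge condition $\mathscr{A}$ if, whenever $S=\{(x_1...x_m)\}\times S_1\times\cdots\times S_n\subset\mathscr{S}_{xy}$ with $S_k$ an open neighborhood of $y_k$, $\Psi^{(m,n)}|_S\in(\mathbb{C}^4)^{\otimes m}\otimes\mathscr{A}_{S_1}\otimes\cdots\otimes\mathscr{A}_{S_n}$ with $\mathscr{A}_{S_k}=\{A|_{S_k}:A\in\mathscr{A}\}$.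 The transformation is applied to $\Psi_0$ obeying $\mathscr{A}(0)$, and $\Psi(s)$ obeys $\mathscr{A}(s)$. Operators $\Theta$. Let $d_s$ denote $d$ restricted to $\mathscr{A}(s)$. For an infinitesimal change from $\mathscr{A}(s)$ to $\mathscr{A}(s+ds)$, $\Theta(s)$ is a linear operator with $A_\mu-\frac1{e_x}\partial_\mu(\Theta(s)A)\,ds=(d_{s+ds}^{-1}d_sA)_\mu$ for all $A\in\mathscr{A}(s)$ to first order in $ds$. It is determined by the starting point $\mathscr{A}(s)$ and the direction (tangent vector) of the path at $\mathscr{A}(s)$, up to addition of a linear map $C:\mathscr{A}(s)\to\mathbb{C}$ (complex numbers regarded as constant functions on $\mathbb{M}^4$). ''A suitable choice of $C$'' means a suitable choice of $\Theta$, within this freedom, for every linear gauge condition and every tangent direction. $\Theta_k$ denotes $\Theta$ acting on the photon variable $y_k$ and index $\mu_k$ (it removes $\mu_k$). Formal setting. All expressions are assumed well defined and sufficiently smooth, including $\Theta$ applied to photon variables of $\Psi$, and the solution $\Psi(s)$, $s\in[0,1]$, with initial value $\Psi(0)=\Psi_0$, of the differential equation $\frac{d}{ds}\Psi(s)^{(m,n)}=-\frac1{e_x}\sum_{k=1}^n\partial_{y_k,\mu_k}\Theta_k(s)\Psi(s)^{(m,n)}+i\sqrt{n+1}\sum_{j=1}^m\bigl(\Theta_{n+1}(s)\Psi(s)^{(m,n+1)}\bigr)(x_1...x_m,y_1...y_n,x_j)$ for all $m,n\ge0$; and operators acting on different variables commute.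
   Formalization: The equation couples n to n+1 without end, so Ψ₀ does not determine its solution (flat functions); the theorem covers only solutions for which the remainder of the K-fold iterated equation, the influence of arbitrarily high photon sectors, tends to 0. *)

(* Defs.v *)
(* Finite index types, big operators and permutations come from MathComp; the
   analysis is over Stdlib's R and Coquelicot's C. *)
From mathcomp Require Import all_boot all_fingroup.
From Stdlib Require Import Reals ClassicalEpsilon.
From Coquelicot Require Import Coquelicot.

Set Implicit Arguments.
Unset Strict Implicit.
Unset Printing Implicit Defensive.

Notation I01 := (fun s : R => (0 <= s <= 1)%R).

(* Derivative at s of a curve [0,1] -> C; one-sided at the end points. *)
Definition is_deriv01 (f : R -> C) (s : R) (l : C) : Prop :=
  filterdiff (K := R_AbsRing) (U := R_NormedModule) (V := C_R_NormedModule)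
    f (within I01 (locally s)) (fun h : R => scal (h : R_AbsRing) l).

Section Tuples.
Variables (X : Type) (n : nat).

Definition upd (y : 'I_n -> X) (k : 'I_n) (z : X) : 'I_n -> X :=
  fun i => if i == k then z else y i.

(* Appending z as the last entry. *)
Definition ext (y : 'I_n -> X) (z : X) : 'I_n.+1 -> X :=
  fun i => if unlift ord_max i is Some k then y k else z.

Definition cat_fun (k : nat) (y : 'I_n -> X) (z : 'I_k -> X) : 'I_(n + k) -> X :=
  fun i => match fintype.split i with inl a => y a | inr b => z b end.

End Tuples.

(* i-th partial derivative; it is only used for functions of class C^1. *)
Definition pd (d : nat) (i : 'I_d) (f : ('I_d -> R) -> C) (x : 'I_d -> R) : C :=
  (Derive (fun t : R => Re (f (upd x i t))) (x i),
   Derive (fun t : R => Im (f (upd x i t))) (x i)).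

Fixpoint Ck (k d : nat) (f : ('I_d -> R) -> C) : Prop :=
  (forall x, continuous f x) /\
  match k with
  | 0 => True
  | k'.+1 => forall i : 'I_d,
      (forall x, ex_derive (K := R_AbsRing) (V := C_R_NormedModule)
                   (fun t : R => f (upd x i t)) (x i)) /\
      Ck k' (pd i f)
  end.

Definition M4 := 'I_4 -> R.
Definition scalar := M4 -> C.
Definition vfield := M4 -> 'I_4 -> C.
Definition tensor := M4 -> 'I_4 -> 'I_4 -> C.

Definition lin (a : C) (A : vfield) (b : C) (B : vfield) : vfield :=
  fun x mu => (a * A x mu + b * B x mu)%C.

Definition vsubspace (V : vfield -> Prop) : Prop :=
  V (fun _ _ => RtoC 0) /\
  forall a b A B, V A -> V B -> V (lin a A b B).

Definition tsubspace (V : tensor -> Prop) : Prop :=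
  V (fun _ _ _ => RtoC 0) /\
  forall (a b : C) F G, V F -> V G ->
    V (fun x mu nu => (a * F x mu nu + b * G x mu nu)%C).

Definition dext (A : vfield) : tensor := fun x mu nu =>
  (pd mu (fun z => A z nu) x - pd nu (fun z => A z mu) x)%C.

(* Linear gauge conditions, for a given space FF of field tensors. *)
Record is_gauge (FF : tensor -> Prop) (G : vfield -> Prop) : Prop := {
  gauge_C2 : forall A, G A -> forall mu, Ck 2 (fun x => A x mu);
  gauge_sub : vsubspace G;
  gauge_to : forall A, G A -> FF (dext A);
  gauge_inj : forall A B, G A -> G B -> dext A = dext B -> A = B;
  gauge_surj : forall F, FF F -> exists2 A, G A & dext A = F }.

(* Inverse of the restriction of d to G; meaningful for a gauge condition G
   and F in FF. *)
Definition dinv (G : vfield -> Prop) (F : tensor) : vfield :=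
  epsilon (inhabits (fun _ _ => RtoC 0)) (fun A => G A /\ dext A = F).

(* A (C^2) path of gauge conditions over [0,1].  The direction of the path at
   s is the s-derivative of the inverse of d on gpos s, a map from FF to vector
   fields, extended by 0 outside FF so that it is determined as a function. *)
Record gpath (FF : tensor -> Prop) := GPath {
  gpos : R -> vfield -> Prop;
  gvel : R -> tensor -> vfield;
  gpos_gauge : forall s, I01 s -> is_gauge FF (gpos s);
  gpos_smooth : forall F, FF F -> exists H : ('I_5 -> R) -> 'I_4 -> C,
    (forall mu, Ck 2 (fun p => H p mu)) /\
    (forall s, I01 s -> forall x mu, dinv (gpos s) F x mu = H (ext x s) mu);
  gvel_deriv : forall s, I01 s -> forall F, FF F -> forall x mu,
    is_deriv01 (fun u => dinv (gpos u) F x mu) s (gvel s F x mu);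
  gvel_out : forall s F, I01 s -> ~ FF F -> gvel s F = (fun _ _ => RtoC 0) }.

Definition is_tangent (FF : tensor -> Prop) (G : vfield -> Prop)
    (T : tensor -> vfield) : Prop :=
  exists (g : gpath FF) (s : R), [/\ I01 s, gpos g s = G & gvel g s = T].

(* To first order in ds, A - (1/e) d(Theta A) ds is the field with the same
   field tensor in the gauge reached from G by moving by ds in direction T. *)
Definition generates (e : R) (G : vfield -> Prop) (T : tensor -> vfield)
    (Theta : vfield -> scalar) : Prop :=
  (forall a b A B, G A -> G B -> forall x,
     Theta (lin a A b B) x = (a * Theta A x + b * Theta B x)%C) /\
  (forall A, G A -> Ck 1 (Theta A) /\
     forall x mu, (- (/ RtoC e * pd mu (Theta A) x))%C = T (dext A) x mu).

(* A choice of Theta at every gauge condition and in every tangent direction. *)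
Definition theta_choice := (vfield -> Prop) -> (tensor -> vfield) -> vfield -> scalar.

Definition admissible (e : R) (FF : tensor -> Prop) (Th : theta_choice) : Prop :=
  (forall G T, is_tangent FF G T -> generates e G T (Th G T)) /\
  (forall (g : gpath FF) F, FF F ->
     continuous_on (fun p : R * M4 => I01 p.1)
       (fun p : R * M4 => Th (gpos g p.1) (gvel g p.1) (dinv (gpos g p.1) F) p.2)).

Definition interval (x y : M4) : R :=
  ((x ord0 - y ord0) ^ 2
   - \big[Rplus/0]_(i < 3) (x (lift ord0 i) - y (lift ord0 i)) ^ 2)%R.

Definition spacelike_or_eq (x y : M4) : Prop := x = y \/ (interval x y < 0)%R.

Definition spacelike (m n : nat) (x : 'I_m -> M4) (y : 'I_n -> M4) : Prop :=
  [/\ forall i j, spacelike_or_eq (x i) (x j),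
      forall k l, spacelike_or_eq (y k) (y l) &
      forall i k, spacelike_or_eq (x i) (y k)].

Definition spacelike_el (m : nat) (x : 'I_m -> M4) : Prop :=
  forall i j, spacelike_or_eq (x i) (x j).

Record config (m n : nat) := Config {
  epos : 'I_m -> M4;
  ppos : 'I_n -> M4;
  config_spacelike : spacelike epos ppos }.

Definition wavefun := forall m n : nat,
  config m n -> ('I_m -> 'I_4) -> ('I_n -> 'I_4) -> C.

Definition antisym_el (Psi : wavefun) : Prop :=
  forall m n (p : 'S_m) (c c' : config m n) sp mu,
    epos c' = (fun i => epos c (p i)) -> ppos c' = ppos c ->
    Psi m n c' (fun i => sp (p i)) mu
    = if odd_perm p then (- Psi m n c sp mu)%C else Psi m n c sp mu.

Definition sym_ph (Psi : wavefun) : Prop :=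
  forall m n (p : 'S_n) (c c' : config m n) sp mu,
    epos c' = epos c -> ppos c' = (fun k => ppos c (p k)) ->
    Psi m n c' sp (fun k => mu (p k)) = Psi m n c sp mu.

(* The tensor sum_i c_i (x) A_i1 (x) ... (x) A_in, with c_i in the m-th tensor
   power of C^4, as a function of spin indices, photon positions and indices. *)
Definition tensor_sum (m n N : nat) (c : 'I_N -> ('I_m -> 'I_4) -> C)
    (A : 'I_N -> 'I_n -> vfield)
    (sp : 'I_m -> 'I_4) (y : 'I_n -> M4) (mu : 'I_n -> 'I_4) : C :=
  \big[Cplus/RtoC 0]_(i < N)
     (c i sp * \big[Cmult/RtoC 1]_(k < n) A i k (y k) (mu k))%C.

Definition obeys_gauge (G : vfield -> Prop) (Psi : wavefun) : Prop :=
  forall m n (x : 'I_m -> M4) (S : 'I_n -> M4 -> Prop)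
    (hS : forall k, open (S k))
    (hSx : forall y, (forall k, S k (y k)) -> spacelike x y),
  exists (N : nat) (c : 'I_N -> ('I_m -> 'I_4) -> C) (A : 'I_N -> 'I_n -> vfield),
    (forall i k, G (A i k)) /\
    forall y (hy : forall k, S k (y k)) sp mu,
      Psi m n (Config (hSx y hy)) sp mu = tensor_sum c A sp y mu.

(* Theta acts on fields defined on all of M4, whereas a photon variable of a
   wave function ranges over a part of M4 only.  A lift of a wave function
   extends its photon variables, one by one, to M4; its values matter at
   spacelike electron positions only. *)
Definition liftfun := forall m n : nat,
  ('I_m -> M4) -> ('I_m -> 'I_4) -> ('I_n -> M4) -> ('I_n -> 'I_4) -> C.

Record is_lift (G : vfield -> Prop) (Psi : wavefun) (f : liftfun) : Prop := {
  lift_restr : forall m n (c : config m n) sp mu,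
    Psi m n c sp mu = f m n (epos c) sp (ppos c) mu;
  lift_gauge : forall m n (x : 'I_m -> M4), spacelike_el x ->
    exists (N : nat) (c : 'I_N -> ('I_m -> 'I_4) -> C) (A : 'I_N -> 'I_n -> vfield),
      (forall i k, G (A i k)) /\
      forall sp y mu, f m n x sp y mu = tensor_sum c A sp y mu;
  lift_sym : forall m n (x : 'I_m -> M4), spacelike_el x ->
    forall (p : 'S_n) sp y mu,
      f m n x sp (fun k => y (p k)) (fun k => mu (p k)) = f m n x sp y mu }.

Definition gauge_rhs (e : R) (Theta : vfield -> scalar) (f : liftfun) : liftfun :=
  fun m n x sp y mu =>
    (- (/ RtoC e) * \big[Cplus/RtoC 0]_(k < n)
         pd (mu k)
            (Theta (fun z nu => f m n x sp (upd y k z) (upd mu k nu))) (y k)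
     + Ci * RtoC (sqrt (INR n.+1)) * \big[Cplus/RtoC 0]_(j < m)
         Theta (fun z nu => f m n.+1 x sp (ext y z) (ext mu nu)) (x j))%C.

Arguments gauge_rhs : clear implicits.

(* (l_0 (x) ... (x) l_(n-1)) h for linear functionals l_k of vector fields. *)
Fixpoint apply_all (n : nat) :
    ('I_n -> vfield -> C) -> (('I_n -> M4) -> ('I_n -> 'I_4) -> C) -> C :=
  match n with
  | 0 => fun _ h => h (fun _ => fun _ => 0%R) (fun _ => ord0)
  | n'.+1 => fun l h =>
      apply_all (fun k => l (lift ord_max k))
        (fun y mu => l ord_max (fun z nu => h (ext y z) (ext mu nu)))
  end.

(* Operators on a photon variable attached to time t of the path g, evaluated
   at z.  The field A is first brought into the gauge gpos g t; then one takes
   its component nu (kind Some nu) or applies Theta(t) (kind None). *)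
Definition phop (FF : tensor -> Prop) (Th : theta_choice) (g : gpath FF)
    (kind : option 'I_4) (t : R) (z : M4) (A : vfield) : C :=
  let B := dinv (gpos g t) (dext A) in
  match kind with
  | Some nu => B z nu
  | None => Th (gpos g t) (gvel g t) B z
  end.

(* In the records below, f s is the lift of the wave function at time s. *)

Record smooth_solution (e : R) (FF : tensor -> Prop) (Th : theta_choice)
    (g : gpath FF) (f : R -> liftfun) : Prop := {
  (* Photon operators depend continuously on all times involved ... *)
  sol_cont : forall m n (x : 'I_m -> M4) sp (kind : 'I_n -> option 'I_4)
      (z : 'I_n -> M4), spacelike_el x ->
    continuous_on (fun p : R * ('I_n -> R) => I01 p.1 /\ forall k, I01 (p.2 k))
      (fun p : R * ('I_n -> R) =>
         apply_all (fun k => phop Th g (kind k) (p.2 k) (z k)) (f p.1 m n x sp));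
  (* ... and commute with d/ds, which acts as the right-hand side. *)
  sol_interchange : forall m n (x : 'I_m -> M4) sp (kind : 'I_n -> option 'I_4)
      (z : 'I_n -> M4) (t : 'I_n -> R) (s : R), spacelike_el x ->
    (forall k, I01 (t k)) -> I01 s ->
    is_deriv01
      (fun u => apply_all (fun k => phop Th g (kind k) (t k) (z k)) (f u m n x sp))
      s
      (apply_all (fun k => phop Th g (kind k) (t k) (z k))
         (gauge_rhs e (Th (gpos g s) (gvel g s)) (f s) m n x sp)) }.

(* The equation couples n to n + 1 without end, so by itself it does not
   determine the solution: u_n' = u_(n+1) with u_n(0) = 0 for all n is solved by
   the derivatives u_n of u_0(s) = exp(-1/s^2).  The solution meant is the one
   built up from the successive infinitesimal steps, for which the influence of
   arbitrarily high photon sectors vanishes.  K-fold iteration of the coupling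
   term bounds the contribution of sector n + K by the quantity below: m^K from
   the sums over the electrons, the square root from the factors
   sqrt(n+1) ... sqrt(n+K), and 1/K! from the volume of the ordered K-tuples of
   times in [0,1].  Wave functions with finitely many photon sectors satisfy the
   condition trivially. *)
Definition high_sectors_vanish (FF : tensor -> Prop) (Th : theta_choice)
    (g : gpath FF) (f : R -> liftfun) : Prop :=
  forall m n (x : 'I_m -> M4) sp (y : 'I_n -> M4) (mu : 'I_n -> 'I_4) (t : R),
    spacelike_el x -> I01 t ->
  forall eps : R, (0 < eps)%R -> exists K0 : nat, forall K : nat, (K0 <= K)%nat ->
  forall (s : R) (v : 'I_K -> R) (j : 'I_K -> 'I_m),
    I01 s -> (forall i, I01 (v i)) ->
    (INR m ^ K * sqrt (INR (n + K)`! / INR n`!) / INR K`!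
     * Cmod (apply_all
               (cat_fun (fun k => phop Th g (Some (mu k)) t (y k))
                        (fun i => phop Th g None (v i) (x (j i))))
               (f s m (n + K)%nat x sp)) <= eps)%R.

(* rep is a convention that assigns to a wave function obeying a gauge
   condition the lift on which operators on photon variables act. *)
Record solution (e : R) (FF : tensor -> Prop) (Th : theta_choice)
    (rep : (vfield -> Prop) -> wavefun -> liftfun)
    (g : gpath FF) (Psi : R -> wavefun) : Prop := {
  sol_antisym : forall s, I01 s -> antisym_el (Psi s);
  sol_sym : forall s, I01 s -> sym_ph (Psi s);
  sol_gauge : forall s, I01 s -> obeys_gauge (gpos g s) (Psi s);
  sol_lift : forall s, I01 s -> is_lift (gpos g s) (Psi s) (rep (gpos g s) (Psi s));
  sol_ode : forall s, I01 s -> forall m n (c : config m n) sp mu,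
    is_deriv01 (fun u => Psi u m n c sp mu) s
      (gauge_rhs e (Th (gpos g s) (gvel g s)) (rep (gpos g s) (Psi s))
         m n (epos c) sp (ppos c) mu);
  sol_smooth : smooth_solution e Th g (fun s => rep (gpos g s) (Psi s));
  sol_high : high_sectors_vanish Th g (fun s => rep (gpos g s) (Psi s)) }.

(* Main.v *)
(* For each field F the fields with tensor F in the gauges A(s) differ by
   gradients, so the s-derivative of the representative of F is the gradient of
   a scalar; Theta is -e times its line integral from the origin, which fixes the
   constants C by making the scalar vanish at 0.  The integral Lambda of Theta
   along a path is then -e times the line integral of the difference of two
   representatives, and depends on the end points of the path only.
   Iterating the equation formally gives, for the components of Psi(1) in the
   final gauge, the series over K of i^K sqrt((n+K)!/n!)/K! times the result of
   applying K copies of the sum over j of Lambda(x_j) to the extra photon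
   variables of Psi(0); the gradient terms of the equation do not contribute
   because the photon operators see field tensors only.  The K-th remainder obeys
   the same linear hierarchy with zero initial values, so integrating it up from
   sector n+K bounds it by the quantity that is assumed to vanish.  Hence Psi(1)
   is the sum of a series built from A(0), A(1) and Psi(0). *)

Require Import Defs.
From HB Require Import structures.
From mathcomp Require Import all_boot all_fingroup.
From Stdlib Require Import Reals Lra FunctionalExtensionality ClassicalEpsilon.
From Coquelicot Require Import Coquelicot.

Set Implicit Arguments.
Unset Strict Implicit.
Unset Printing Implicit Defensive.

Local Open Scope R_scope.

(** Ordered products of [Theta] at different times would in general remember the path. The order
    disappears because the operators sit on different photon variables of a symmetric function:
    there they form a tensor product, all [K] of them may be replaced by the same integrated
    operator, and the simplex of ordered times becomes the factor 1/K!. No iterated integral appears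
    below; the closed form is differentiated instead, and the symmetry enters through the product
    rule in [slots_deriv]. A further obstacle is that each [Theta(s)] lives on its own space
    [gpos g s], whereas the wave function at one time must be probed by operators of other times.
    Precomposing every operator with [dext] and the inverse of [d] gives all of them the common
    domain [Vdom]. On [Psi(1)] and in the gauge of time 1 this precomposition changes nothing, so
    the final components are still read off exactly. *)

HB.instance Definition _ := Monoid.isComLaw.Build R 0 Rplus
  (fun x y z => esym (Rplus_assoc x y z)) Rplus_comm Rplus_0_l.
HB.instance Definition _ := Monoid.isComLaw.Build C (RtoC 0) Cplus
  Cplus_assoc Cplus_comm Cplus_0_l.
HB.instance Definition _ := Monoid.isComLaw.Build C (RtoC 1) Cmult
  Cmult_assoc Cmult_comm Cmult_1_l.
HB.instance Definition _ := Monoid.isMulLaw.Build C (RtoC 0) Cmult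
  Cmult_0_l Cmult_0_r.
HB.instance Definition _ := Monoid.isAddLaw.Build C Cmult Cplus
  Cmult_plus_distr_r Cmult_plus_distr_l.

(** * Calculus in coordinates *)

Section Coordinates.
Variable d : nat.
Implicit Types (x : 'I_d -> R) (f : ('I_d -> R) -> R).

Lemma upd_same X (x : 'I_d -> X) i t : upd x i t i = t.
Proof. by rewrite /upd eqxx. Qed.

Lemma upd_id X (x : 'I_d -> X) i : upd x i (x i) = x.
Proof. by apply: functional_extensionality => j; rewrite /upd; case: eqP => [->|]. Qed.

Lemma upd_upd X (x : 'I_d -> X) i t u : upd (upd x i t) i u = upd x i u.
Proof. by apply: functional_extensionality => j; rewrite /upd; case: eqP. Qed.

Lemma upd_comm X (x : 'I_d -> X) i j t u :
  i != j -> upd (upd x i t) j u = upd (upd x j u) i t.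
Proof.
move=> nij; apply: functional_extensionality => k; rewrite /upd.
case: eqP => [->|//]; by rewrite eq_sym (negbTE nij).
Qed.

(** The uniform structure on ['I_d -> R] is that of uniform convergence; finiteness of the index set
    is what makes coordinatewise continuity sufficient in [continuous_coord]. *)
Lemma filter_ord (T : Type) (F : (T -> Prop) -> Prop) (P : 'I_d -> T -> Prop) :
  Filter F -> (forall i, F (P i)) -> F (fun u => forall i, P i u).
Proof.
move=> FF HP.
have H : forall s : seq 'I_d, F (fun u => forall i, i \in s -> P i u).
  elim=> [|i s IH]; first by apply: filter_forall.
  apply: filter_imp (filter_and _ _ (HP i) IH) => u [h1 h2] j.
  by rewrite inE => /orP[/eqP->//|/h2].
apply: filter_imp (H (enum 'I_d)) => u h i; apply: h; exact: mem_enum.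
Qed.

Lemma continuous_coord (U : UniformSpace) (p : U -> 'I_d -> R) u :
  (forall i, continuous (fun v => p v i) u) -> continuous p u.
Proof.
move=> H P [eps HP].
have := @filter_ord _ (locally u) (fun i v => ball (p u i) eps (p v i)) _ _.
move=> /(_ _) [].
  move=> i; apply: (H i (ball (p u i) eps)); exact: locally_ball.
by move=> del Hd; exists del => v /Hd h; apply: HP.
Qed.

Lemma continuous_eval x i : continuous (fun x : 'I_d -> R => x i) x.
Proof. by move=> P [eps HP]; exists eps => y hy; apply: HP; apply: hy. Qed.

Lemma continuous_upd (U : UniformSpace) (p : U -> 'I_d -> R) (q : U -> R) i u :
  (forall j, continuous (fun v => p v j) u) -> continuous q u ->
  continuous (fun v => upd (p v) i (q v)) u.
Proof.
by move=> hp hq; apply: continuous_coord => j; rewrite /upd; case: eqP.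
Qed.

Definition pdR (i : 'I_d) f x : R := Derive (fun t => f (upd x i t)) (x i).

(** Schwarz's theorem and differentiation under the integral are used for real functions; [CkP] is
    the bridge from here to [Ck]. *)
Fixpoint CkR (k : nat) f : Prop :=
  (forall x, continuous f x) /\
  match k with
  | 0%nat => True
  | k'.+1 => forall i : 'I_d,
      (forall x, ex_derive (fun t : R => f (upd x i t)) (x i)) /\ CkR k' (pdR i f)
  end.

Lemma CkR_cont k f x : CkR k f -> continuous f x.
Proof. by case: k => [|k] []. Qed.

Lemma CkR_is_derive k f : CkR k.+1 f -> forall x i t,
  is_derive (fun t => f (upd x i t)) t (pdR i f (upd x i t)).
Proof.
move=> [_ H] x i t; rewrite /pdR upd_same.
have -> : (fun t0 => f (upd (upd x i t) i t0)) = (fun t0 => f (upd x i t0)).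
  by apply: functional_extensionality => u; rewrite upd_upd.
apply: Derive_correct.
have := (H i).1 (upd x i t); rewrite upd_same.
by apply: ex_derive_ext => u; rewrite upd_upd.
Qed.

Lemma CkR_sub k f : CkR k.+1 f -> CkR k f.
Proof.
elim: k f => [|k IH] f /=; first by move=> [h _].
by move=> [h1 h2]; split=> // i; split; [exact: (h2 i).1 | apply: IH; apply: (h2 i).2].
Qed.

Lemma continuous_comp_CkR k f (U : UniformSpace) (p : U -> 'I_d -> R) u :
  CkR k f -> (forall i, continuous (fun v => p v i) u) -> continuous (fun v => f (p v)) u.
Proof.
move=> hf hp; apply: (continuous_comp p f); first exact: continuous_coord.
exact: CkR_cont hf.
Qed.

(** The varied coordinate [i] may be a space-time coordinate, as in [is_derive_lineR], or the path
    parameter adjoined as a fifth coordinate, as in [dC_line]. *)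
Lemma is_derive_RInt_upd f (p : R -> 'I_d -> R) i a b u0 :
  CkR 1 f -> (forall j t, continuous (fun t' => p t' j) t) ->
  is_derive (fun u => RInt (fun t => f (upd (p t) i u)) a b) u0
            (RInt (fun t => pdR i f (upd (p t) i u0)) a b).
Proof.
move=> hf hp.
have E u t : Derive (fun z => f (upd (p t) i z)) u = pdR i f (upd (p t) i u).
  by apply: is_derive_unique; apply: (CkR_is_derive hf).
have -> : (fun t => pdR i f (upd (p t) i u0)) = (fun t => Derive (fun u => f (upd (p t) i u)) u0).
  by apply: functional_extensionality => t; rewrite E.
apply: (@is_derive_RInt_param (fun u t => f (upd (p t) i u))).
- by apply: filter_forall => u t _; eexists; apply: (CkR_is_derive hf).
- move=> t _; apply/continuity_2d_pt_filterlim.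
  have -> : (fun z : R * R => Derive (fun z0 => f (upd (p z.2) i z0)) z.1)
     = (fun z : R * R => pdR i f (upd (p z.2) i z.1)).
    by apply: functional_extensionality => z; rewrite E.
  rewrite E.
  apply: (@continuous_comp (prod_UniformSpace R_UniformSpace R_UniformSpace) _ _
           (fun z : R * R => upd (p z.2) i z.1) (pdR i f) (u0, t)).
    apply: continuous_upd; last exact: continuous_fst.
    by move=> j; apply: (continuous_comp snd (fun t => p t j)); [exact: continuous_snd|exact: hp].
  by apply: (@CkR_cont 0); apply: (hf.2 i).2.
- apply: filter_forall => u; apply: ex_RInt_continuous => t _.
  apply: (continuous_comp_CkR hf) => j.
  by rewrite /upd; case: eqP => _; [exact: continuous_const| exact: hp].
Qed.

Lemma schwarz f : CkR 2 f -> forall i j x, pdR i (pdR j f) x = pdR j (pdR i f) x.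
Proof.
move=> hf i j x; case: (altP (i =P j)) => [->//|nij].
pose g u v := f (upd (upd x i u) j v).
have hf1 := CkR_sub hf.
have gE u v : g u v = f (upd (upd x j v) i u) by rewrite /g upd_comm.
have D1 u v : is_derive (fun z => g z v) u (pdR i f (upd (upd x j v) i u)).
  have -> : (fun z => g z v) = (fun z => f (upd (upd x j v) i z)).
    by apply: functional_extensionality => z; rewrite gE.
  exact: (CkR_is_derive hf1).
have D2 u v : is_derive (fun z => g u z) v (pdR j f (upd (upd x i u) j v)).
  exact: (CkR_is_derive hf1).
have E1 v : Derive (fun z => g z v) = (fun u => pdR i f (upd (upd x i u) j v)).
  by apply: functional_extensionality => u; rewrite (is_derive_unique _ _ _ (D1 u v)) upd_comm // eq_sym.
have E2 u : Derive (fun z => g u z) = (fun v => pdR j f (upd (upd x j v) i u)).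
  by apply: functional_extensionality => v; rewrite (is_derive_unique _ _ _ (D2 u v)) upd_comm.
have Da u v : is_derive (fun z => Derive (fun t => g z t) v) u (pdR i (pdR j f) (upd (upd x j v) i u)).
  have -> : (fun z => Derive (fun t => g z t) v) = (fun z => pdR j f (upd (upd x j v) i z)).
    by apply: functional_extensionality => w; rewrite E2.
  by apply: (@CkR_is_derive 0); apply: (hf.2 j).2.
have Db u v : is_derive (fun z => Derive (fun t => g t z) u) v (pdR j (pdR i f) (upd (upd x i u) j v)).
  have -> : (fun z => Derive (fun t => g t z) u) = (fun z => pdR i f (upd (upd x i u) j z)).
    by apply: functional_extensionality => w; rewrite E1.
  by apply: (@CkR_is_derive 0); apply: (hf.2 i).2.
have C k (h : ('I_d -> R) -> R) (a b : 'I_d) u v : CkR k h ->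
  continuity_2d_pt (fun u v => h (upd (upd x a u) b v)) u v.
  move=> hh; apply/continuity_2d_pt_filterlim.
  apply: (continuous_comp_CkR (U := prod_UniformSpace R_UniformSpace R_UniformSpace)
       (p := fun z : R * R => upd (upd x a z.1) b z.2) (u := (u, v)) hh).
  move=> k'; rewrite /upd; case: eqP => _; first exact: continuous_snd.
  by case: eqP => _; [exact: continuous_fst | exact: continuous_const].
have := @Schwarz g (x i) (x j).
rewrite (is_derive_unique _ _ _ (Da _ _)) (is_derive_unique _ _ _ (Db _ _)) !upd_id.
have -> : (fun u v => Derive (fun z => Derive (fun t => g z t) v) u) =
   (fun u v => pdR i (pdR j f) (upd (upd x i u) j v)).
  apply: functional_extensionality => u; apply: functional_extensionality => v.
  by rewrite (is_derive_unique _ _ _ (Da _ _)) upd_comm // eq_sym.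
have -> : (fun u v => Derive (fun z => Derive (fun t => g t z) u) v) =
   (fun u v => pdR j (pdR i f) (upd (upd x i u) j v)).
  apply: functional_extensionality => u; apply: functional_extensionality => v.
  by rewrite (is_derive_unique _ _ _ (Db _ _)).
apply.
- exists (mkposreal 1 Rlt_0_1) => u v _ _; split; [|split; [|split]]; eexists.
  + exact: D1.
  + exact: D2.
  + exact: Da.
  + exact: Db.
- apply: (C 0%nat (pdR i (pdR j f)) i j (x i) (x j)); apply: ((hf.2 j).2.2 i).2.
- apply: (C 0%nat (pdR j (pdR i f)) i j (x i) (x j)); apply: ((hf.2 i).2.2 j).2.
Qed.

End Coordinates.

(** * Continuity of integrals depending on a parameter *)

Lemma continuous_pair_l (U V : UniformSpace) (W : UniformSpace) (h : U * V -> W) u v :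
  continuous h (u, v) -> continuous (fun t => h (u, t)) v.
Proof.
move=> H; apply: (@continuous_comp_2 V U V W (fun=> u) (fun t => t) (fun a b => h (a, b)) v).
- exact: continuous_const.
- exact: continuous_id.
- by apply: continuous_ext H; case.
Qed.

Lemma continuous_RInt_param01 (U : UniformSpace) (h : U -> R -> R) u0 :
  (forall u t, continuous (fun p : U * R => h p.1 p.2) (u, t)) ->
  continuous (fun u => RInt (h u) 0 1) u0.
Proof.
move=> H.
(* [filterlim_RInt] asks for convergence uniform on all of R; clamping the variable to [0,1] leaves
   the integral unchanged and lets compactness provide it. *)
pose cl t := Rmax 0 (Rmin 1 t).
have cl01 t : 0 <= cl t <= 1.
  rewrite /cl; split; first exact: Rmax_l.
  by apply: Rmax_lub; [lra | exact: Rmin_l].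
have clid t : Rmin 0 1 < t < Rmax 0 1 -> cl t = t.
  rewrite Rmin_left ?Rmax_right; try lra.
  by move=> [h1 h2]; rewrite /cl Rmin_right ?Rmax_right; lra.
have ex u : is_RInt (fun t => h u (cl t)) 0 1 (RInt (h u) 0 1).
  apply: (is_RInt_ext (h u)) => [t /clid->//|].
  apply: (RInt_correct (h u)); apply: ex_RInt_continuous => t _.
  exact: (continuous_pair_l (H u t)).
have lim : filterlim (fun u t => h u (cl t)) (locally u0)
    (locally ((fun t => h u0 (cl t)) : fct_UniformSpace R R_UniformSpace)).
  apply/filterlim_locally => eps.
  have e2 : 0 < eps / 2 by case: eps => e he /=; lra.
  have W t : {d : posreal | forall u t', ball u0 d u -> ball t d t' ->
      ball (h u0 t) (eps / 2) (h u t')}.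
    apply: constructive_indefinite_description.
    have /filterlim_locally /(_ (mkposreal _ e2)) [d Hd] := H u0 t.
    by exists d => u t' h1 h2; apply: (Hd (u, t')); split.
  have [d Hd] := compactness_value_1d 0 1 (fun t => proj1_sig (W t)).
  exists d => u Hu t.
  (* The compactness theorem yields its covering point only under a double negation, which [NNPP]
     removes at the end. *)
  have K : ~ ~ ball (h u0 (cl t)) eps (h u (cl t)).
    move=> N; apply: (Hd (cl t) (cl01 t)) => -[s [_ [h1 h2]]]; apply: N.
    have hs := proj2_sig (W s).
    have -> : (eps : R) = eps / 2 + eps / 2 by lra.
    apply: (ball_triangle _ (h u0 s)).
      by apply/ball_sym/hs => //; exact: ball_center.
    by apply: hs => //; apply: ball_le Hu.
  exact: Classical_Prop.NNPP.
have [I [h1 h2]] := @filterlim_RInt _ _ _ 0 1 (locally u0) _ _ _ ex lim.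
have e : I = RInt (h u0) 0 1.
  exact: (eq_trans (esym (is_RInt_unique _ _ _ _ h2)) (is_RInt_unique _ _ _ _ (ex u0))).
by rewrite /continuous -e.
Qed.

Lemma continuous_RInt_param (U : UniformSpace) (h : U -> R -> R) (b : U -> R) u0 :
  (forall u t, continuous (fun p : U * R => h p.1 p.2) (u, t)) ->
  (forall u, continuous b u) ->
  continuous (fun u => RInt (h u) 0 (b u)) u0.
Proof.
move=> H hb.
(* Substituting [b u * t] for the variable trades the moving end point for a parameter in the
   integrand; [b u] may have either sign or be 0. *)
apply: (continuous_ext (fun u => RInt (fun t => b u * h u (b u * t)) 0 1)).
  move=> u; have := @RInt_comp_lin R_CompleteNormedModule (h u) (b u) 0 0 1.
  rewrite !Rmult_0_r !Rplus_0_r Rmult_1_r => <-.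
    by apply: RInt_ext => t _; rewrite Rplus_0_r.
  by apply: ex_RInt_continuous => t _; exact: (continuous_pair_l (H u t)).
apply: (continuous_RInt_param01 (h := fun u t => b u * h u (b u * t))) => u t.
have cb : continuous (fun p : U * R => b p.1) (u, t).
  by apply: (continuous_comp fst b); [exact: continuous_fst | exact: hb].
apply: (continuous_mult (K := R_AbsRing)) => //.
apply: (@continuous_comp_2 (prod_UniformSpace U R_UniformSpace) U R_UniformSpace R_UniformSpace
  (fun p => p.1) (fun p => b p.1 * p.2) h (u, t)).
- exact: continuous_fst.
- by apply: (continuous_mult (K := R_AbsRing)) => //; exact: continuous_snd.
- exact: H.
Qed.

Lemma continuous_bigR (U : UniformSpace) n (F : 'I_n -> U -> R) u :
  (forall i, continuous (F i) u) ->
  continuous (fun v => \big[Rplus/0]_(i < n) F i v) u.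
Proof.
elim: n F => [|n IH] F HF.
  apply: (continuous_ext (fun=> 0)); last exact: continuous_const.
  by move=> v; rewrite big_ord0.
apply: (continuous_ext (fun v => \big[Rplus/0]_(i < n) F (widen_ord (leqnSn n) i) v + F ord_max v)).
  by move=> v; rewrite big_ord_recr.
by apply: (continuous_plus (K := R_AbsRing) (V := R_NormedModule)) => //; apply: IH.
Qed.

Lemma is_derive_bigR n (F : 'I_n -> R -> R) (D : 'I_n -> R) u :
  (forall i, is_derive (F i) u (D i)) ->
  is_derive (fun v => \big[Rplus/0]_(i < n) F i v) u (\big[Rplus/0]_(i < n) D i).
Proof.
elim: n F D => [|n IH] F D HF.
  rewrite big_ord0; apply: (is_derive_ext (fun=> 0)); last exact: is_derive_const.
  by move=> v; rewrite big_ord0.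
rewrite big_ord_recr.
apply: (is_derive_ext (fun v => \big[Rplus/0]_(i < n) F (widen_ord (leqnSn n) i) v + F ord_max v)).
  by move=> v; rewrite big_ord_recr.
by apply: (is_derive_plus (K := R_AbsRing) (V := R_NormedModule)) => //; apply: IH.
Qed.

Lemma telescope_R (b : nat -> R) n :
  \big[Rplus/0]_(i < n) (b i.+1 - b i) = b n - b 0%nat.
Proof.
by elim: n => [|n IH]; rewrite ?big_ord0 ?big_ord_recr /= ?IH; lra.
Qed.

(** * Staircase line integrals *)

Section Line.
Variable d : nat.
Implicit Types (x : 'I_d -> R) (a : 'I_d -> ('I_d -> R) -> R).

Definition trunc (k : nat) x : 'I_d -> R := fun i => if (i < k)%nat then x i else 0.

(* Integral of [a] along the staircase path from 0 to [x] that runs parallel to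
   the coordinate axes, in the order of the coordinates. *)
Definition lineR a x : R :=
  \big[Rplus/0]_(mu < d) RInt (fun t => a mu (upd (trunc mu x) mu t)) 0 (x mu).

Lemma trunc_last x (mu : 'I_d) : upd (trunc mu x) mu (x mu) = trunc mu.+1 x.
Proof.
apply: functional_extensionality => i; rewrite /upd /trunc ltnS (leq_eqVlt i).
have -> : (nat_of_ord i == mu) = (i == mu) by [].
by case: eqP => [->|].
Qed.

Lemma trunc_first x (mu : 'I_d) : upd (trunc mu x) mu 0 = trunc mu x.
Proof.
apply: functional_extensionality => i; rewrite /upd /trunc.
by case: eqP => [->|//]; rewrite ltnn.
Qed.

Lemma trunc_all x : trunc d x = x.
Proof. by apply: functional_extensionality => i; rewrite /trunc ltn_ord. Qed.

Lemma trunc_upd x k (nu : 'I_d) t :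
  trunc k (upd x nu t) = if (nu < k)%nat then upd (trunc k x) nu t else trunc k x.
Proof.
apply: functional_extensionality => i; rewrite /trunc /upd.
case: (altP (i =P nu)) => [->|n]; first by case: ifP => h; rewrite ?eqxx ?h.
by case: (nu < k)%nat; rewrite ?(negbTE n).
Qed.

Lemma continuous_stair x (mu : 'I_d) (f : ('I_d -> R) -> R) t :
  CkR 0 f -> continuous (fun t => f (upd (trunc mu x) mu t)) t.
Proof.
move=> hf; apply: (continuous_comp_CkR hf) => i; rewrite /upd; case: eqP => _.
  exact: continuous_id.
exact: continuous_const.
Qed.

Lemma ex_RInt_stair x (mu : 'I_d) (f : ('I_d -> R) -> R) u v :
  CkR 0 f -> ex_RInt (fun t => f (upd (trunc mu x) mu t)) u v.
Proof. by move=> hf; apply: ex_RInt_continuous => t _; exact: continuous_stair. Qed.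

(* Since [a] is closed, the derivative along [nu] of a segment with [mu > nu] is
   an increment of [a nu], and these increments telescope. *)
Lemma is_derive_lineR a x nu :
  (forall mu, CkR 1 (a mu)) ->
  (forall mu nu x, pdR nu (a mu) x = pdR mu (a nu) x) ->
  is_derive (fun t => lineR a (upd x nu t)) (x nu) (a nu x).
Proof.
move=> ha hc.
(* The value 0 up to [nu] makes the three cases uniform: segments before [nu] do not move, and the
   segment [nu] contributes all of [a nu (trunc nu.+1 x)] by the fundamental theorem. *)
pose b k := if (k <= nu)%nat then 0 else a nu (trunc k x).
have -> : a nu x = \big[Rplus/0]_(mu < d) (b mu.+1 - b mu).
  by rewrite telescope_R /b leqNgt ltn_ord /= trunc_all; lra.
apply: (is_derive_bigR
  (F := fun mu t => RInt (fun s => a mu (upd (trunc mu (upd x nu t)) mu s)) 0 (upd x nu t mu))).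
move=> mu; have ca : CkR 0 (a mu) := CkR_sub (ha mu).
rewrite /b; case: (ltngtP mu nu) => cmp.
- rewrite Rminus_0_r.
  apply: (is_derive_ext (fun=> RInt (fun s => a mu (upd (trunc mu x) mu s)) 0 (x mu))).
    move=> t; rewrite trunc_upd ltnNge (ltnW cmp) /=; congr (RInt _ _ _).
    by rewrite /upd; case: eqP cmp => // ->; rewrite ltnn.
  exact: is_derive_const.
- have nmu : nu != mu by apply: contraTneq cmp => ->; rewrite ltnn.
  apply: (is_derive_ext (fun t => RInt (fun s => a mu (upd (upd (trunc mu x) mu s) nu t)) 0 (x mu))).
    move=> t; rewrite trunc_upd cmp.
    have -> : upd x nu t mu = x mu by rewrite /upd eq_sym (negbTE nmu).
    by apply: RInt_ext => s _; rewrite upd_comm // eq_sym.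
  have -> : a nu (trunc mu.+1 x) - a nu (trunc mu x) = RInt (fun s => pdR nu (a mu) (upd (upd (trunc mu x) mu s) nu (x nu))) 0 (x mu).
    have E : is_RInt (fun s => pdR mu (a nu) (upd (trunc mu x) mu s)) 0 (x mu)
         (minus (a nu (upd (trunc mu x) mu (x mu))) (a nu (upd (trunc mu x) mu 0))).
      apply: (is_RInt_derive (fun s => a nu (upd (trunc mu x) mu s))) => s _.
        exact: (CkR_is_derive (ha nu)).
      by apply: continuous_stair; apply: ((ha nu).2 mu).2.
    rewrite trunc_last trunc_first in E; apply: (eq_trans (esym (is_RInt_unique _ _ _ _ E))); apply: RInt_ext => s _.
    rewrite hc; congr (pdR _ _ _); rewrite upd_comm 1?eq_sym //; congr (upd _ _ _).
    apply: functional_extensionality => i; rewrite /upd /trunc.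
    by case: eqP => [->|//]; rewrite cmp.
  apply: (is_derive_RInt_upd (p := fun s => upd (trunc mu x) mu s)) => // j t.
  by rewrite /upd; case: eqP => _; [exact: continuous_id | exact: continuous_const].
- have {cmp} -> : mu = nu by apply: val_inj.
  rewrite Rminus_0_r -trunc_last.
  apply: (is_derive_ext (fun t => RInt (fun s => a nu (upd (trunc nu x) nu s)) 0 t)).
    by move=> t; rewrite trunc_upd ltnn upd_same.
  apply: (is_derive_RInt (fun s => a nu (upd (trunc nu x) nu s)) _ 0).
    apply: filter_forall => t; apply: (RInt_correct (fun s => _)); exact: (ex_RInt_stair _ _ _ _ (CkR_sub (ha nu))).
  exact: continuous_stair (CkR_sub (ha nu)).
Qed.

Lemma lineR_lin a b (r s : R) x :
  (forall mu, CkR 0 (a mu)) -> (forall mu, CkR 0 (b mu)) ->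
  lineR (fun mu z => r * a mu z + s * b mu z) x = r * lineR a x + s * lineR b x.
Proof.
move=> ha hb; rewrite /lineR.
have L (f : 'I_d -> R) (c : R) : c * \big[Rplus/0]_(i < d) f i = \big[Rplus/0]_(i < d) (c * f i).
  by apply: (big_morph (fun z => c * z)) => [u v|]; lra.
rewrite !L -big_split; apply: eq_bigr => mu _ /=.
have ea := ex_RInt_stair x mu 0 (x mu) (ha mu).
have eb := ex_RInt_stair x mu 0 (x mu) (hb mu).
have := @RInt_plus R_CompleteNormedModule (fun t => scal r (a mu (upd (trunc mu x) mu t)))
   (fun t => scal s (b mu (upd (trunc mu x) mu t))) 0 (x mu).
move=> -> //; first rewrite !RInt_scal //.
- exact: ex_RInt_scal.
- exact: ex_RInt_scal.
Qed.

End Line.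

(** * One-sided derivatives on the unit interval *)

(** Stdlib's [D_in] is relative to a set, hence one-sided at 0 and 1, and brings sum and product
    rules with it. *)
Definition dI (f : R -> R) (s l : R) : Prop := D_in f (fun=> l) I01 s.

Lemma dI_eps f s l :
  (forall eps, 0 < eps -> exists2 del, 0 < del & forall u, I01 u -> Rabs (u - s) < del ->
     Rabs (f u - f s - (u - s) * l) <= eps * Rabs (u - s)) -> dI f s l.
Proof.
move=> H eps heps; have [del hd Hd] := H (eps / 2) ltac:(lra).
exists del; split=> // u [[hu nus] hus].
rewrite /= /R_dist /Rdist in hus *.
have n0 : u - s <> 0 by move=> h; apply: nus; lra.
have -> : (f u - f s) / (u - s) - l = (f u - f s - (u - s) * l) / (u - s) by field.
rewrite /Rdiv Rabs_mult Rabs_inv.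
have p : 0 < Rabs (u - s) by apply: Rabs_pos_lt.
apply: (Rle_lt_trans _ (eps / 2)); last lra.
apply: (Rmult_le_reg_r (Rabs (u - s))) => //.
rewrite Rmult_assoc Rinv_l; last lra.
by rewrite Rmult_1_r; apply: Hd.
Qed.

Lemma dI_of_derive f s l : is_derive f s l -> dI f s l.
Proof.
move=> [_ /(_ s (fun P h => h)) H]; apply: dI_eps => eps heps.
have [del Hd] := H (mkposreal _ heps).
exists del; first exact: cond_pos.
by move=> u _ hu; have := Hd u hu.
Qed.

Lemma dI_ext f g s l : I01 s -> (forall u, I01 u -> f u = g u) -> dI f s l -> dI g s l.
Proof.
move=> hs E H eps he; have [al [ha Ha]] := H eps he; exists al; split=> // u hu.
by rewrite -(E u hu.1.1) -(E s hs); apply: Ha.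
Qed.

Lemma dI_unique f s l l' : I01 s -> dI f s l -> dI f s l' -> l = l'.
Proof.
move=> [h0 h1]; apply: single_limit => al hal.
(* Uniqueness needs points of [0,1] arbitrarily close to [s] and different from it: to its right in
   the left half, to its left otherwise. *)
case: (Rle_lt_dec s (1 / 2)) => c.
  exists (s + Rmin (al / 2) (1 / 2)).
  have m1 := Rmin_l (al / 2) (1 / 2); have m2 := Rmin_r (al / 2) (1 / 2).
  have m3 : 0 < Rmin (al / 2) (1 / 2) by apply: Rmin_pos; lra.
  split; first by split; [split; lra | lra].
  by rewrite /Rdist Rabs_pos_eq; lra.
exists (s - Rmin (al / 2) (1 / 2)).
have m1 := Rmin_l (al / 2) (1 / 2); have m2 := Rmin_r (al / 2) (1 / 2).
have m3 : 0 < Rmin (al / 2) (1 / 2) by apply: Rmin_pos; lra.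
split; first by split; [split; lra | lra].
by rewrite /Rdist Rabs_left; lra.
Qed.

Lemma dI_const c s : dI (fun=> c) s 0.
Proof. exact: (Dconst I01 c s). Qed.

Lemma dI_plus f g s l m : dI f s l -> dI g s m -> dI (fun u => f u + g u) s (l + m).
Proof. exact: Dadd. Qed.

Lemma dI_mult f g s l m : dI f s l -> dI g s m ->
  dI (fun u => f u * g u) s (l * g s + f s * m).
Proof. by move=> hf hg; have := Dmult I01 (fun=> l) (fun=> m) f g s hf hg. Qed.

Lemma dI_scal c f s l : dI f s l -> dI (fun u => c * f u) s (c * l).
Proof.
by move=> hf; have := dI_mult (dI_const c s) hf; rewrite Rmult_0_l Rplus_0_l.
Qed.

Lemma dI_congr f g s l m : (forall u, f u = g u) -> l = m -> dI f s l -> dI g s m.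
Proof. by move=> /functional_extensionality -> ->. Qed.

Lemma dI_nonincreasing u du :
  (forall s, I01 s -> dI u s (du s)) -> (forall s, I01 s -> du s <= 0) ->
  forall s, I01 s -> u s <= u 0.
Proof.
move=> hu hdu s hs; rewrite /= in hs.
(* [MVT_gen] requires two-sided continuity at the ends of the interval, where [u] may be controlled
   from one side only; composing with the 1-Lipschitz clamp extends [u] by constants. *)
pose cl t := Rmax 0 (Rmin 1 t).
have cl01 t : I01 (cl t).
  rewrite /cl; split; first exact: Rmax_l.
  by apply: Rmax_lub; [lra | exact: Rmin_l].
have clid t : I01 t -> cl t = t.
  by move=> [h1 h2]; rewrite /cl Rmin_right ?Rmax_right; lra.
have cll t t' : Rabs (cl t - cl t') <= Rabs (t - t').
  have cl3 r : [\/ r <= 0 /\ cl r = 0, I01 r /\ cl r = r | 1 <= r /\ cl r = 1].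
    case: (Rle_dec r 0) => c0.
      by apply: Or31; split=> //; rewrite /cl Rmin_right ?Rmax_left; lra.
    case: (Rle_dec r 1) => c1; first by apply: Or32; split; [lra | apply: clid; lra].
    by apply: Or33; split; first lra; rewrite /cl Rmin_left ?Rmax_right; lra.
  by case: (cl3 t) => -[? ->]; case: (cl3 t') => -[? ->];
     rewrite /Rabs; do ![case: Rcase_abs => ?]; lra.
have [|t _|c [hc E]] := @MVT_gen (fun t => u (cl t)) 0 s du.
- rewrite Rmin_left ?Rmax_right; try lra.
  move=> t ht; apply/is_derive_Reals => eps he.
  have ht' : I01 t by split; lra.
  have [al [hal Hal]] := hu t ht' eps he.
  have dp : 0 < Rmin al (Rmin t (1 - t)) by apply: Rmin_pos => //; apply: Rmin_pos; lra.
  exists (mkposreal _ dp) => h nh /= hh.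
  have m1 := Rmin_l al (Rmin t (1 - t)); have m2 := Rmin_r al (Rmin t (1 - t)).
  have m3 := Rmin_l t (1 - t); have m4 := Rmin_r t (1 - t).
  have hth : I01 (t + h) by have := Rabs_def2 _ _ hh; split; lra.
  rewrite !clid //.
  have := Hal (t + h); rewrite /= /Rdist; have -> : t + h - t = h by lra.
  apply; split; last by lra.
  by split=> // e; apply: nh; lra.
- move=> eps he.
  have [al [hal Hal]] := cont_deriv u (fun=> du (cl t)) I01 (cl t) (hu _ (cl01 t)) eps he.
  exists al; split=> // t' [[_ _] ht'].
  case: (Req_dec (cl t') (cl t)) => [->|n]; first by rewrite /= /R_dist /Rdist Rminus_diag Rabs_R0.
  apply: Hal; split; first by split=> // e; apply: n.
  exact: Rle_lt_trans (cll _ _) ht'.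
- rewrite Rmin_left ?Rmax_right in hc; try lra.
  rewrite (clid s) // (clid 0) in E; last by split; lra.
  have h1 := hdu c ltac:(split; lra).
  have : 0 <= (- du c) * (s - 0) by apply: Rmult_le_pos; lra.
  by lra.
Qed.

Definition dC (f : R -> C) (s : R) (l : C) : Prop :=
  dI (fun u => Re (f u)) s (Re l) /\ dI (fun u => Im (f u)) s (Im l).

Lemma norm_Cmod (z : C_R_NormedModule) : norm z = Cmod z.
Proof.
change (norm z) with (sqrt (Rabs (fst z) ^ 2 + Rabs (snd z) ^ 2)).
by rewrite !pow2_abs.
Qed.

Lemma Rabs_Re_le_norm (z : C_R_NormedModule) : Rabs (Re z) <= norm z.
Proof. by rewrite norm_Cmod; exact: Rle_trans (Rmax_l _ _) (Rmax_Cmod _). Qed.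

Lemma Rabs_Im_le_norm (z : C_R_NormedModule) : Rabs (Im z) <= norm z.
Proof. by rewrite norm_Cmod; exact: Rle_trans (Rmax_r _ _) (Rmax_Cmod _). Qed.

Lemma is_deriv01_dC f s l : is_deriv01 f s l -> dC f s l.
Proof.
move=> [_ /(_ s)] H.
have lim : is_filter_lim (within I01 (locally s)) s by move=> P; apply: filter_imp.
have {lim}H := H lim.
split; apply: dI_eps => eps he; have [del Hd] := H (mkposreal _ he);
  exists del; try exact: cond_pos; move=> u hu hus; have := Hd u hus hu.
  by apply: Rle_trans; apply: (Rabs_Re_le_norm (minus (minus (f u) (f s)) (scal (minus u s) (l : C_R_NormedModule)))).
by apply: Rle_trans; apply: (Rabs_Im_le_norm (minus (minus (f u) (f s)) (scal (minus u s) (l : C_R_NormedModule)))).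
Qed.

Lemma dC_ext f g s l : I01 s -> (forall u, I01 u -> f u = g u) -> dC f s l -> dC g s l.
Proof.
by move=> hs E [h1 h2]; split; [apply: dI_ext h1 | apply: dI_ext h2] => // u hu; rewrite E.
Qed.

Lemma dC_unique f s l l' : I01 s -> dC f s l -> dC f s l' -> l = l'.
Proof.
move=> hs [h1 h2] [h1' h2']; have := dI_unique hs h1 h1'; have := dI_unique hs h2 h2'.
by case: l {h1 h2} => a b; case: l' {h1' h2'} => a' b' /= -> ->.
Qed.

Lemma dC_const c s : dC (fun=> c) s (RtoC 0).
Proof. by split; apply: dI_const. Qed.

Lemma dC_plus f g s l m : dC f s l -> dC g s m -> dC (fun u => f u + g u)%C s (l + m)%C.
Proof. by move=> [h1 h2] [h1' h2']; split; apply: dI_plus. Qed.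

Lemma dC_mult f g s l m : dC f s l -> dC g s m ->
  dC (fun u => f u * g u)%C s (l * g s + f s * m)%C.
Proof.
move=> [h1 h2] [h1' h2']; split.
  apply: dI_congr (dI_plus (dI_mult h1 h1') (dI_scal (-1) (dI_mult h2 h2'))).
    by move=> u; rewrite /Re /Im /=; ring.
  by rewrite /Re /Im /=; ring.
apply: dI_congr (dI_plus (dI_mult h1 h2') (dI_mult h2 h1')) => //.
by rewrite /Re /Im /=; ring.
Qed.

Lemma dC_congr f g s l m : (forall u, f u = g u) -> l = m -> dC f s l -> dC g s m.
Proof. by move=> /functional_extensionality -> ->. Qed.

Lemma dC_scal c f s l : dC f s l -> dC (fun u => c * f u)%C s (c * l)%C.
Proof.
move=> hf; apply: dC_congr (dC_mult (dC_const c s) hf) => //.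
by rewrite Cmult_0_l Cplus_0_l.
Qed.

Lemma dC_minus f g s l m : dC f s l -> dC g s m -> dC (fun u => f u - g u)%C s (l - m)%C.
Proof.
have E a b : (a + - RtoC 1 * b)%C = (a - b)%C by ring.
by move=> hf hg; apply: dC_congr (dC_plus hf (dC_scal (- RtoC 1)%C hg)).
Qed.

Lemma dC_big (I : Type) (r : seq I) (F : I -> R -> C) (D : I -> C) s :
  (forall i, dC (F i) s (D i)) ->
  dC (fun u => \big[Cplus/RtoC 0]_(i <- r) F i u) s (\big[Cplus/RtoC 0]_(i <- r) D i).
Proof.
move=> H; elim: r => [|i r IH].
  by apply: dC_congr (dC_const 0 s) => [u|]; rewrite big_nil.
by apply: dC_congr (dC_plus (H i) IH) => [u|]; rewrite big_cons.
Qed.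

(* The real monotonicity statement is applied to the component of [r] in the
   direction of [r s]. *)
Lemma Cmod_dC_le r dr g dg :
  (forall s, I01 s -> dC r s (dr s)) -> r 0 = RtoC 0 ->
  (forall s, I01 s -> dI g s (dg s)) -> g 0 = 0 ->
  (forall s, I01 s -> Cmod (dr s) <= dg s) ->
  forall s, I01 s -> Cmod (r s) <= g s.
Proof.
move=> hr r0 hg g0 hd s hs.
have sq z : Cmod z * Cmod z = Re z * Re z + Im z * Im z.
  by rewrite /Cmod sqrt_sqrt /Re /Im; [ring | nra].
(* For [r s = 0] there is no direction and the zero vector serves: norm at most 1 is enough for the
   bound [cs]. The vector [(a, b)] stays fixed while the time runs. *)
have [a [b [hab E]]] : exists a b, a * a + b * b <= 1 /\ a * Re (r s) + b * Im (r s) = Cmod (r s).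
  case: (Req_dec (Cmod (r s)) 0) => [h|h].
    by exists 0, 0; rewrite h; split; lra.
  exists (Re (r s) / Cmod (r s)), (Im (r s) / Cmod (r s)).
  have := sq (r s); move: (Re _) (Im _) (Cmod _) h => x y m nm Em.
  have -> : x / m * (x / m) + y / m * (y / m) = (x * x + y * y) / (m * m) by field.
  have -> : x / m * x + y / m * y = (x * x + y * y) / m by field.
  by rewrite -Em; split; [right|]; field.
have cs z : a * Re z + b * Im z <= Cmod z.
  apply: Rsqr_incr_0_var; last exact: Cmod_ge_0.
  rewrite /Rsqr sq; move: (Re z) (Im z) => x y.
  (* Lagrange's identity: the squares of [a * x + b * y] and of [a * y - b * x] add up to
     [(a * a + b * b) * (x * x + y * y)]. *)
  have h1 := Rle_0_sqr (a * y - b * x); rewrite /Rsqr in h1.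
  have h2 : 0 <= (1 - (a * a + b * b)) * (x * x + y * y) by apply: Rmult_le_pos; nra.
  lra.
have := @dI_nonincreasing (fun t => a * Re (r t) + b * Im (r t) + -1 * g t)
  (fun t => a * Re (dr t) + b * Im (dr t) + -1 * dg t) _ _ s hs.
rewrite E r0 g0 /= => H; suff: Cmod (r s) + -1 * g s <= 0 by lra.
apply: Rle_trans (H _ _) _; try lra.
  move=> t ht; have [h1 h2] := hr t ht.
  by apply: dI_plus; [apply: dI_plus|]; apply: dI_scal => //; apply: hg.
by move=> t ht; have := cs (dr t); have := hd t ht; lra.
Qed.

Lemma C_eq (z w : C) : Re z = Re w -> Im z = Im w -> z = w.
Proof. by case: z => a b; case: w => a' b' /= -> ->. Qed.

(** * Differentiability classes of real and complex functions *)

Section RealCk.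
Variable d : nat.
Implicit Types (f g : ('I_d -> R) -> R).

Lemma pdR_lin k r s f g i x : CkR k.+1 f -> CkR k.+1 g ->
  pdR i (fun x => r * f x + s * g x) x = r * pdR i f x + s * pdR i g x.
Proof.
move=> hf hg; apply: is_derive_unique.
have E h : CkR k.+1 h -> is_derive (fun t => h (upd x i t)) (x i) (pdR i h x).
  by move=> /CkR_is_derive/(_ x i (x i)); rewrite upd_id.
apply: (is_derive_plus (K := R_AbsRing) (V := R_NormedModule));
  by apply: is_derive_scal; apply: E.
Qed.

Lemma CkR_lin k r s f g : CkR k f -> CkR k g -> CkR k (fun x => r * f x + s * g x).
Proof.
have cc h h' x : continuous h x -> continuous h' x -> continuous (fun x => r * h x + s * h' x) x.
  move=> ch ch'; apply: (continuous_plus (K := R_AbsRing) (V := R_NormedModule));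
  by apply: (continuous_mult (K := R_AbsRing)) => //; exact: continuous_const.
elim: k f g => [|k IH] f g hf hg; split=> //.
- by move=> x; apply: cc; apply: CkR_cont; eassumption.
- by move=> x; apply: cc; apply: CkR_cont; eassumption.
- move=> i; split=> [x|].
    by apply: (ex_derive_plus (K := R_AbsRing) (V := R_NormedModule)); apply: ex_derive_scal;
      [apply: (hf.2 i).1 | apply: (hg.2 i).1].
  have -> : pdR i (fun x => r * f x + s * g x) = (fun x => r * pdR i f x + s * pdR i g x).
    by apply: functional_extensionality => x; exact: (pdR_lin r s i x hf hg).
  by apply: IH; [apply: (hf.2 i).2 | apply: (hg.2 i).2].
Qed.

End RealCk.

Section ComplexCk.
Variable d : nat.
Implicit Types (f g : ('I_d -> R) -> C).

Lemma continuous_Re_Im (U : UniformSpace) (f : U -> C) x :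
  continuous (fun x => Re (f x)) x -> continuous (fun x => Im (f x)) x -> continuous f x.
Proof.
move=> h1 h2 P [eps HP].
have /filterlim_locally /(_ eps) g1 := h1; have /filterlim_locally /(_ eps) g2 := h2.
by apply: filter_imp (filter_and _ _ g1 g2) => y [? ?]; apply: HP; split.
Qed.

Lemma continuous_Re (U : UniformSpace) (f : U -> C) x :
  continuous f x -> continuous (fun x => Re (f x)) x.
Proof.
move=> /filterlim_locally h; apply/filterlim_locally => eps.
by apply: filter_imp (h eps) => y [].
Qed.

Lemma continuous_Im (U : UniformSpace) (f : U -> C) x :
  continuous f x -> continuous (fun x => Im (f x)) x.
Proof.
move=> /filterlim_locally h; apply/filterlim_locally => eps.
by apply: filter_imp (h eps) => y [].
Qed.

Lemma ex_derive_C (f : R -> C) x :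
  @ex_derive R_AbsRing C_R_NormedModule f x <->
  ex_derive (fun t => Re (f t)) x /\ ex_derive (fun t => Im (f t)) x.
Proof.
split=> [[l [_ H]]|[h1 h2]].
  have {}H := H x (fun P hP => hP).
  split; [exists (Re l) | exists (Im l)]; split; try exact: is_linear_scal_l;
    move=> y hy; have {hy} <- := is_filter_lim_locally_unique _ _ hy;
    move=> eps; apply: filter_imp (H eps) => z; apply: Rle_trans.
    exact: (Rabs_Re_le_norm (minus (minus (f z) (f x)) (scal (minus z x) (l : C_R_NormedModule)))).
  exact: (Rabs_Im_le_norm (minus (minus (f z) (f x)) (scal (minus z x) (l : C_R_NormedModule)))).
apply: (ex_derive_ext (V := C_R_NormedModule)
   (fun t => plus (scal (Re (f t)) ((1, 0) : C_R_NormedModule)) (scal (Im (f t)) ((0, 1) : C_R_NormedModule)))).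
  move=> t; rewrite [RHS]surjective_pairing.
  by congr pair; rewrite /= /plus /scal /= /mult /= /Re /Im; ring.
apply: (ex_derive_plus (V := C_R_NormedModule)).
  exact: (ex_derive_scal_l (V := C_R_NormedModule)).
exact: (ex_derive_scal_l (V := C_R_NormedModule)).
Qed.

Lemma CkP k f : Ck k f <-> CkR k (fun x => Re (f x)) /\ CkR k (fun x => Im (f x)).
Proof.
elim: k f => [|k IH] f.
  split; first by move=> [h _]; split; split=> // x; [apply: continuous_Re | apply: continuous_Im].
  by move=> [[h1 _] [h2 _]]; split=> // x; apply: continuous_Re_Im.
split.
  move=> [h H]; split; split=> [x|i]; try by [apply: continuous_Re | apply: continuous_Im].
    by split=> [x|]; [apply: (iffLR (ex_derive_C _ _) ((H i).1 x)).1 | apply: (iffLR (IH (pd i f)) (H i).2).1].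
  by split=> [x|]; [apply: (iffLR (ex_derive_C _ _) ((H i).1 x)).2 | apply: (iffLR (IH (pd i f)) (H i).2).2].
move=> [[h1 H1] [h2 H2]]; split=> [x|i]; first exact: continuous_Re_Im.
split=> [x|]; first by apply/ex_derive_C; split; [apply: (H1 i).1 | apply: (H2 i).1].
by apply/IH; split; [apply: (H1 i).2 | apply: (H2 i).2].
Qed.

Lemma Ck_le k f : Ck k.+1 f -> Ck k f.
Proof. by move=> /CkP[h1 h2]; apply/CkP; split; apply: CkR_sub. Qed.

Lemma Ck_pd k f i : Ck k.+1 f -> Ck k (pd i f).
Proof. by move=> [_ /(_ i)[]]. Qed.

(** The factors 1 bring the right-hand side into the shape of nested two-term combinations, so that
    [CkR_lin], [pdR_lin] and [lineR_lin] can be applied to it twice. *)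
Lemma Re_lin (a b z w : C) :
  Re (a * z + b * w)%C = 1 * (Re a * Re z + - Im a * Im z) + 1 * (Re b * Re w + - Im b * Im w).
Proof. by rewrite /Re /Im /=; ring. Qed.

Lemma Im_lin (a b z w : C) :
  Im (a * z + b * w)%C = 1 * (Re a * Im z + Im a * Re z) + 1 * (Re b * Im w + Im b * Re w).
Proof. by rewrite /Re /Im /=; ring. Qed.

Lemma Ck_lin k a b f g : Ck k f -> Ck k g -> Ck k (fun x => a * f x + b * g x)%C.
Proof.
move=> /CkP[f1 f2] /CkP[g1 g2]; apply/CkP; split.
  have -> : (fun x => Re (a * f x + b * g x)) = _
    := functional_extensionality _ _ (fun x => Re_lin a b (f x) (g x)).
  by do 2!apply: CkR_lin => //; apply: CkR_lin.
have -> : (fun x => Im (a * f x + b * g x)) = _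
  := functional_extensionality _ _ (fun x => Im_lin a b (f x) (g x)).
by do 2!apply: CkR_lin => //; apply: CkR_lin.
Qed.

Lemma pd_lin a b f g i x : Ck 1 f -> Ck 1 g ->
  pd i (fun x => a * f x + b * g x)%C x = (a * pd i f x + b * pd i g x)%C.
Proof.
move=> /CkP[f1 f2] /CkP[g1 g2]; apply: C_eq.
  rewrite Re_lin; change (pdR i (fun x => Re (a * f x + b * g x)%C) x = 
    1 * (Re a * pdR i (fun x => Re (f x)) x + - Im a * pdR i (fun x => Im (f x)) x) +
    1 * (Re b * pdR i (fun x => Re (g x)) x + - Im b * pdR i (fun x => Im (g x)) x)).
  have -> : (fun x => Re (a * f x + b * g x)) = _
    := functional_extensionality _ _ (fun x => Re_lin a b (f x) (g x)).
  by rewrite !(pdR_lin (k := 0)) //; apply: CkR_lin.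
rewrite Im_lin; change (pdR i (fun x => Im (a * f x + b * g x)%C) x = 
    1 * (Re a * pdR i (fun x => Im (f x)) x + Im a * pdR i (fun x => Re (f x)) x) +
    1 * (Re b * pdR i (fun x => Im (g x)) x + Im b * pdR i (fun x => Re (g x)) x)).
have -> : (fun x => Im (a * f x + b * g x)) = _
  := functional_extensionality _ _ (fun x => Im_lin a b (f x) (g x)).
by rewrite !(pdR_lin (k := 0)) //; apply: CkR_lin.
Qed.

Lemma pd_pd f i j x : Ck 2 f -> pd i (pd j f) x = pd j (pd i f) x.
Proof. by move=> /CkP[f1 f2]; apply: C_eq; [exact: (schwarz f1) | exact: (schwarz f2)]. Qed.

End ComplexCk.

(** * Slices of functions with one further real variable *)

Section Slices.
Variable d : nat.

Lemma ext_max (X : Type) (x : 'I_d -> X) s : ext x s ord_max = s.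
Proof. by rewrite /ext unlift_none. Qed.

Lemma ext_lift (X : Type) (x : 'I_d -> X) s i : ext x s (lift ord_max i) = x i.
Proof. by rewrite /ext liftK. Qed.

Lemma upd_ext_max (X : Type) (x : 'I_d -> X) s t : upd (ext x s) ord_max t = ext x t.
Proof.
apply: functional_extensionality => j; rewrite /upd /ext.
by case: unliftP => [k ->|->]; rewrite ?eqxx // eq_sym (negbTE (neq_lift _ _)).
Qed.

Lemma upd_ext_lift (X : Type) (x : 'I_d -> X) s i t :
  upd (ext x s) (lift ord_max i) t = ext (upd x i t) s.
Proof.
apply: functional_extensionality => j; rewrite /upd /ext.
case: unliftP => [k ->|->]; first by rewrite (inj_eq lift_inj).
by rewrite (negbTE (neq_lift _ _)).
Qed.

Lemma continuous_ext_arg (U : UniformSpace) (p : U -> 'I_d -> R) (q : U -> R) u :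
  (forall i, continuous (fun v => p v i) u) -> continuous q u ->
  forall j, continuous (fun v => ext (p v) (q v) j) u.
Proof. by move=> hp hq j; rewrite /ext; case: unlift. Qed.

Lemma pd_slice (K : ('I_d.+1 -> R) -> C) s i x :
  pd i (fun x => K (ext x s)) x = pd (lift ord_max i) K (ext x s).
Proof.
rewrite /pd ext_lift; congr (_, _); congr (Derive _ _);
  by apply: functional_extensionality => t; rewrite upd_ext_lift.
Qed.

Lemma Ck_slice k (K : ('I_d.+1 -> R) -> C) s : Ck k K -> Ck k (fun x => K (ext x s)).
Proof.
have cc h x : (forall x, continuous h x) -> continuous (fun x : 'I_d -> R => (h (ext x s) : C)) x.
  move=> hh; apply: (continuous_comp (fun x : 'I_d -> R => ext x s) h) => //.
  apply: continuous_coord; apply: continuous_ext_arg; last exact: continuous_const.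
  by move=> i; exact: continuous_eval.
elim: k K => [|k IH] K [h1 h2]; split=> //; try by move=> x; apply: cc.
move=> i; split=> [x|].
  have := (h2 (lift ord_max i)).1 (ext x s); rewrite ext_lift.
  by apply: (ex_derive_ext (V := C_R_NormedModule)) => t; rewrite upd_ext_lift.
have -> : pd i (fun x => K (ext x s)) = (fun x => pd (lift ord_max i) K (ext x s)).
  by apply: functional_extensionality => x; rewrite pd_slice.
by apply: IH; apply: (h2 _).2.
Qed.

Lemma dC_slice (K : ('I_d.+1 -> R) -> C) x s :
  Ck 1 K -> dC (fun u => K (ext x u)) s (pd ord_max K (ext x s)).
Proof.
move=> /CkP[h1 h2]; split; apply: dI_of_derive.
  have := CkR_is_derive h1 (ext x s) ord_max s; rewrite upd_ext_max.
  by apply: is_derive_ext => t; rewrite upd_ext_max.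
have := CkR_is_derive h2 (ext x s) ord_max s; rewrite upd_ext_max.
by apply: is_derive_ext => t; rewrite upd_ext_max.
Qed.

End Slices.

(** * Vector fields, field tensors and line integrals *)

Definition vCk (k : nat) (A : vfield) : Prop := forall mu, Ck k (fun x => A x mu).

Lemma vCk_lin k a b A B : vCk k A -> vCk k B -> vCk k (lin a A b B).
Proof. by move=> hA hB mu; apply: Ck_lin. Qed.

Definition tlin (a : C) (F : tensor) (b : C) (G : tensor) : tensor :=
  fun x mu nu => (a * F x mu nu + b * G x mu nu)%C.

Lemma vfield_ext (A B : vfield) : (forall x mu, A x mu = B x mu) -> A = B.
Proof.
by move=> h; apply: functional_extensionality => x; apply: functional_extensionality => mu.
Qed.

Lemma tensor_ext (F G : tensor) : (forall x mu nu, F x mu nu = G x mu nu) -> F = G.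
Proof.
move=> h; apply: functional_extensionality => x; apply: functional_extensionality => mu.
by apply: functional_extensionality => nu.
Qed.

Lemma dext_lin a b A B : vCk 1 A -> vCk 1 B ->
  dext (lin a A b B) = tlin a (dext A) b (dext B).
Proof.
by move=> hA hB; apply: tensor_ext => x mu nu; rewrite /dext /lin !pd_lin // /tlin; ring.
Qed.

Lemma dext0 : dext (fun _ _ => RtoC 0) = (fun _ _ _ => RtoC 0).
Proof.
apply: tensor_ext => x mu nu; rewrite /dext /pd /= !Derive_const.
by apply: C_eq; rewrite /=; ring.
Qed.

Definition line (A : vfield) : scalar := fun x =>
  (lineR (fun mu z => Re (A z mu)) x, lineR (fun mu z => Im (A z mu)) x).

Lemma line_is_derive A x nu :
  vCk 1 A -> dext A = (fun _ _ _ => RtoC 0) ->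
  is_derive (fun t => Re (line A (upd x nu t))) (x nu) (Re (A x nu)) /\
  is_derive (fun t => Im (line A (upd x nu t))) (x nu) (Im (A x nu)).
Proof.
move=> hA h0.
have E mu nu' z : pd nu' (fun z => A z mu) z = pd mu (fun z => A z nu') z.
  have := f_equal (fun f => f z nu' mu) h0; rewrite /dext => h.
  by rewrite -[RHS]Cplus_0_r -h; ring.
split; apply: (is_derive_lineR (a := fun mu z => _ (A z mu))).
- by move=> mu; have /CkP[] := hA mu.
- by move=> mu nu' z; exact: (f_equal (fun c : C => c.1) (E mu nu' z)).
- by move=> mu; have /CkP[] := hA mu.
- by move=> mu nu' z; exact: (f_equal (fun c : C => c.2) (E mu nu' z)).
Qed.

Lemma pd_line A x nu : vCk 1 A -> dext A = (fun _ _ _ => RtoC 0) ->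
  pd nu (line A) x = A x nu.
Proof.
move=> hA h0; have [h1 h2] := line_is_derive x nu hA h0.
by apply: C_eq; apply: is_derive_unique.
Qed.

(** Joint continuity of [h] is phrased through arbitrary maps from a space [W], because it is needed
    with the integration variable adjoined, on the product of [U] with R. *)
Lemma continuous_lineR (U : UniformSpace) d (h : 'I_d -> U -> ('I_d -> R) -> R)
    (p : U -> 'I_d -> R) u :
  (forall mu (W : UniformSpace) (f : W -> U) (q : W -> 'I_d -> R) w,
     continuous f w -> (forall i, continuous (fun w => q w i) w) ->
     continuous (fun w => h mu (f w) (q w)) w) ->
  (forall v i, continuous (fun v => p v i) v) ->
  continuous (fun v => lineR (fun mu => h mu v) (p v)) u.
Proof.
move=> hh hp; apply: continuous_bigR => mu.
apply: (continuous_RInt_param (h := fun v t => h mu v (upd (trunc mu (p v)) mu t)) (b := fun v => p v mu)) => //.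
move=> v t; apply: (hh mu (prod_UniformSpace U R_UniformSpace) (fun p => p.1)).
  exact: continuous_fst.
move=> i; rewrite /upd; case: eqP => _; first exact: continuous_snd.
rewrite /trunc; case: (i < mu)%nat; last exact: continuous_const.
by apply: (continuous_comp fst (fun v => p v i)); [exact: continuous_fst | exact: hp].
Qed.

Lemma continuous_line A x : vCk 0 A -> continuous (line A) x.
Proof.
move=> hA; apply: continuous_Re_Im;
  apply: (continuous_lineR (U := fct_UniformSpace 'I_4 R_UniformSpace)
     (h := fun mu _ z => _ (A z mu)) (p := fun x => x)) => [mu W f q w _ hq|y i];
  try exact: continuous_eval.
  by have /CkP[h _] := hA mu; apply: (continuous_comp_CkR h).
by have /CkP[_ h] := hA mu; apply: (continuous_comp_CkR h).
Qed.

Lemma line_Ck1 A : vCk 1 A -> dext A = (fun _ _ _ => RtoC 0) -> Ck 1 (line A).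
Proof.
move=> hA h0; split=> [x|nu].
  by apply: continuous_line => mu; apply: Ck_le.
split=> [x|].
  by have [h1 h2] := line_is_derive x nu hA h0; apply/ex_derive_C; split; eexists; eassumption.
have -> : pd nu (line A) = (fun x => A x nu).
  by apply: functional_extensionality => x; exact: pd_line.
by apply: (@Ck_le _ 0); apply: hA.
Qed.

Lemma line_lin a b A B x : vCk 0 A -> vCk 0 B ->
  line (lin a A b B) x = (a * line A x + b * line B x)%C.
Proof.
move=> hA hB.
have A1 mu : CkR 0 (fun z => Re (A z mu)) by have /CkP[] := hA mu.
have A2 mu : CkR 0 (fun z => Im (A z mu)) by have /CkP[] := hA mu.
have B1 mu : CkR 0 (fun z => Re (B z mu)) by have /CkP[] := hB mu.
have B2 mu : CkR 0 (fun z => Im (B z mu)) by have /CkP[] := hB mu.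
apply: C_eq.
  rewrite Re_lin /line /=.
  have -> : (fun mu z => Re (lin a A b B z mu)) = (fun mu z => 1 * (Re a * Re (A z mu) + - Im a * Im (A z mu))
     + 1 * (Re b * Re (B z mu) + - Im b * Im (B z mu))).
    apply: functional_extensionality => mu; apply: functional_extensionality => z; exact: Re_lin.
  by rewrite !(lineR_lin (a := fun mu z => _) (b := fun mu z => _)) => // mu; apply: CkR_lin.
rewrite Im_lin /line /=.
have -> : (fun mu z => Im (lin a A b B z mu)) = (fun mu z => 1 * (Re a * Im (A z mu) + Im a * Re (A z mu))
     + 1 * (Re b * Im (B z mu) + Im b * Re (B z mu))).
  apply: functional_extensionality => mu; apply: functional_extensionality => z; exact: Im_lin.
by rewrite !(lineR_lin (a := fun mu z => _) (b := fun mu z => _)) => // mu; apply: CkR_lin.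
Qed.

(** Path derivative and line integral commute because the staircase from 0 to [x] does not depend on
    the time. This makes [theta] the time derivative of [gshift]. *)
Lemma dC_line (H : ('I_5 -> R) -> 'I_4 -> C) x s :
  (forall mu, Ck 1 (fun p => H p mu)) ->
  dC (fun u => line (fun z => H (ext z u)) x) s
     (line (fun z mu => pd ord_max (fun p => H p mu) (ext z s)) x).
Proof.
move=> hH.
have K (f : 'I_4 -> ('I_5 -> R) -> R) : (forall mu, CkR 1 (f mu)) ->
    dI (fun u => lineR (fun mu z => f mu (ext z u)) x) s
       (lineR (fun mu z => pdR ord_max (f mu) (ext z s)) x).
  move=> hf; apply: dI_of_derive.
  apply: (is_derive_bigR (F := fun mu u => RInt (fun t => f mu (ext (upd (trunc mu x) mu t) u)) 0 (x mu))) => mu.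
  (* The last coordinate 0 is a dummy: [upd] at [ord_max] overwrites it by the time. *)
  have := @is_derive_RInt_upd _ (f mu) (fun t => ext (upd (trunc mu x) mu t) 0) ord_max 0 (x mu) s (hf mu).
  have -> : (fun u => RInt (fun t => f mu (upd (ext (upd (trunc mu x) mu t) 0) ord_max u)) 0 (x mu))
    = (fun u => RInt (fun t => f mu (ext (upd (trunc mu x) mu t) u)) 0 (x mu)).
    apply: functional_extensionality => u; apply: RInt_ext => t _; by rewrite upd_ext_max.
  have -> : RInt (fun t => pdR ord_max (f mu) (upd (ext (upd (trunc mu x) mu t) 0) ord_max s)) 0 (x mu)
    = RInt (fun t => pdR ord_max (f mu) (ext (upd (trunc mu x) mu t) s)) 0 (x mu).
    apply: RInt_ext => t _; by rewrite upd_ext_max.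
  apply=> j t; apply: continuous_ext_arg; last exact: continuous_const.
  by move=> i; rewrite /upd; case: eqP => _; [exact: continuous_id | exact: continuous_const].
split.
  by apply: (K (fun mu p => Re (H p mu))) => mu; have /CkP[] := hH mu.
by apply: (K (fun mu p => Im (H p mu))) => mu; have /CkP[] := hH mu.
Qed.

(** * Gauge conditions and the choice of Theta *)

Section Gauges.
Variables (FF : tensor -> Prop) (hFF : tsubspace FF).

Section OneGauge.
Variables (G : vfield -> Prop) (hG : is_gauge FF G).

Lemma dinv_spec F : FF F -> G (dinv G F) /\ dext (dinv G F) = F.
Proof.
move=> /(gauge_surj hG)[A hA dA].
by apply: (@epsilon_spec _ _ (fun A => G A /\ dext A = F)); exists A.
Qed.

Lemma gauge_vCk A : G A -> vCk 1 A.
Proof. by move=> hA mu; apply: Ck_le; apply: (gauge_C2 hG). Qed.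

Lemma dinv_dext A : G A -> dinv G (dext A) = A.
Proof.
move=> hA; have [h1 h2] := dinv_spec (gauge_to hG hA).
exact: (gauge_inj hG h1 hA h2).
Qed.

Lemma FF_tlin a b F F' : FF F -> FF F' -> FF (tlin a F b F').
Proof. by move=> h h'; apply: hFF.2. Qed.

Lemma dinv_lin a b F F' : FF F -> FF F' ->
  dinv G (tlin a F b F') = lin a (dinv G F) b (dinv G F').
Proof.
move=> h h'; have [g1 e1] := dinv_spec h; have [g2 e2] := dinv_spec h'.
rewrite -{1}e1 -{1}e2 -dext_lin; try exact: gauge_vCk.
by apply: dinv_dext; apply: (gauge_sub hG).2.
Qed.

Lemma dinv0 : dinv G (fun _ _ _ => RtoC 0) = (fun _ _ => RtoC 0).
Proof. by rewrite -dext0 (dinv_dext (gauge_sub hG).1). Qed.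

End OneGauge.

Section Path.
Variable g : gpath FF.

(** One-sided derivatives on [0,1] are unique, so the prescribed direction must be the fifth partial
    derivative of the smooth family, also at the end points. Regularity and field tensor of [gvel]
    are then read off from [H]. *)
Lemma gpos_field F : FF F -> exists H : ('I_5 -> R) -> 'I_4 -> C,
  [/\ forall mu, Ck 2 (fun p => H p mu),
      forall s, I01 s -> dinv (gpos g s) F = (fun z => H (ext z s)) &
      forall s, I01 s -> gvel g s F = (fun z mu => pd ord_max (fun p => H p mu) (ext z s))].
Proof.
move=> hF; have [H [h2 hd]] := gpos_smooth g hF; exists H.
have E s : I01 s -> dinv (gpos g s) F = (fun z => H (ext z s)).
  by move=> hs; apply: vfield_ext => x mu; apply: hd.
split=> // s hs; apply: vfield_ext => x mu.
have h1 := is_deriv01_dC (gvel_deriv g hs hF x mu).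
apply: (dC_unique hs h1); apply: dC_ext hs _ (dC_slice x s (Ck_le (h2 mu))).
by move=> u hu; rewrite (E u hu).
Qed.

Lemma gvel_vCk s F : I01 s -> FF F -> vCk 1 (gvel g s F).
Proof.
move=> hs /gpos_field[H [h2 _ ->//]] mu.
exact: (Ck_slice (K := pd ord_max (fun p => H p mu))) (Ck_pd _ (h2 mu)).
Qed.

Lemma gvel_lin s a b F F' : I01 s -> FF F -> FF F' ->
  gvel g s (tlin a F b F') = lin a (gvel g s F) b (gvel g s F').
Proof.
move=> hs h h'; apply: vfield_ext => x mu.
have h1 := is_deriv01_dC (gvel_deriv g hs (FF_tlin a b h h') x mu).
apply: (dC_unique hs h1).
have d1 := is_deriv01_dC (gvel_deriv g hs h x mu).
have d2 := is_deriv01_dC (gvel_deriv g hs h' x mu).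
apply: dC_ext hs _ (dC_plus (dC_scal a d1) (dC_scal b d2)) => u hu.
by rewrite (dinv_lin (gpos_gauge g hu)).
Qed.

(* The field tensor of [dinv (gpos g u) F] is [F] for all [u]. *)
Lemma dext_gvel s F : I01 s -> FF F -> dext (gvel g s F) = (fun _ _ _ => RtoC 0).
Proof.
move=> hs hF; have [H [h2 hd hv]] := gpos_field hF.
apply: tensor_ext => x mu nu; rewrite hv // /dext.
rewrite (pd_slice (pd ord_max (fun p => H p nu))) (pd_slice (pd ord_max (fun p => H p mu))).
(* Symmetry of second derivatives puts the time derivative outermost, where it acts on the constant
   component [F x mu nu]. *)
rewrite !(pd_pd (lift ord_max _) ord_max) //.
have D i j : dC (fun u => pd i (fun z => H (ext z u) j) x) s
    (pd ord_max (pd (lift ord_max i) (fun p => H p j)) (ext x s)).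
  apply: dC_congr (dC_slice x s (Ck_pd (lift ord_max i) (h2 j))) => // u.
  by rewrite (pd_slice (fun p => H p j)).
apply: (dC_unique hs (dC_minus (D mu nu) (D nu mu))).
apply: dC_ext hs _ (dC_const (F x mu nu) s) => u hu.
have [_ {1}<-] := dinv_spec (gpos_gauge g hu) hF.
by rewrite /dext hd.
Qed.

End Path.

Variables (e : R) (he : e <> 0).

(* The additive constant is fixed by requiring the scalar to vanish at 0. *)
Definition theta : theta_choice := fun _ T A => line (fun x mu => - RtoC e * T (dext A) x mu)%C.

Lemma scale_lin (c : C) (A : vfield) : (fun x mu => c * A x mu)%C = lin c A (RtoC 0) A.
Proof. by apply: vfield_ext => x mu; rewrite /lin; ring. Qed.

Lemma thetaE G T A x : vCk 0 (T (dext A)) -> theta G T A x = (- RtoC e * line (T (dext A)) x)%C.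
Proof. by move=> h; rewrite /theta scale_lin line_lin //; ring. Qed.

Lemma theta_generates G T : is_tangent FF G T -> generates e G T (theta G T).
Proof.
move=> [g [s [hs <- <-]]]; have hG := gpos_gauge g hs.
have vT A : gpos g s A -> vCk 1 (gvel g s (dext A)).
  by move=> hA; apply: gvel_vCk => //; apply: (gauge_to hG).
have vT0 A : gpos g s A -> vCk 0 (gvel g s (dext A)) by move=> hA mu; apply/Ck_le/vT.
split=> [a b A B hA hB x | A hA].
  have FA := gauge_to hG hA; have FB := gauge_to hG hB.
  have E : gvel g s (dext (lin a A b B)) = lin a (gvel g s (dext A)) b (gvel g s (dext B)).
    by rewrite dext_lin ?gvel_lin //; apply: gauge_vCk hG _ _.
  rewrite !thetaE ?E ?line_lin //; try exact: vT0; last by apply: vCk_lin; apply: vT0.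
  ring.
have hv : vCk 1 (fun x mu => - RtoC e * gvel g s (dext A) x mu)%C.
  by rewrite scale_lin; apply: vCk_lin; apply: vT.
have h0 : dext (fun x mu => - RtoC e * gvel g s (dext A) x mu)%C = (fun _ _ _ => RtoC 0).
  rewrite scale_lin dext_lin; try exact: vT.
  rewrite dext_gvel //; last exact: gauge_to hG _ hA.
  by apply: tensor_ext => x mu nu; rewrite /tlin; ring.
split; first exact: line_Ck1.
move=> x mu; rewrite /theta pd_line //; field.
by move=> h; apply: he; apply: RtoC_inj.
Qed.

Lemma theta_continuous (g : gpath FF) F : FF F ->
  continuous_on (fun p : R * M4 => I01 p.1)
    (fun p : R * M4 => theta (gpos g p.1) (gvel g p.1) (dinv (gpos g p.1) F) p.2).
Proof.
move=> hF; have [H [h2 hd hv]] := gpos_field g hF.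
(* [H] is defined for all real times, so [L] extends the expression beyond [0,1] and plain
   continuity of [L] suffices. The summand with coefficient 0 gives [D] the form required by
   [Ck_lin]. *)
pose D mu := (fun p => - RtoC e * pd ord_max (fun p => H p mu) p + RtoC 0 * pd ord_max (fun p => H p mu) p)%C.
pose L (p : R * M4) := line (fun z mu => D mu (ext z p.1)) p.2.
have LE p : I01 p.1 -> theta (gpos g p.1) (gvel g p.1) (dinv (gpos g p.1) F) p.2 = L p.
  move=> hp; rewrite /theta /L (dinv_spec (gpos_gauge g hp) hF).2 hv //; congr line.
  by apply: vfield_ext => z mu; rewrite /D; ring.
move=> p hp; rewrite LE //.
suff lim : @continuous (prod_UniformSpace R_UniformSpace (fct_UniformSpace 'I_4 R_UniformSpace)) _ L p.
  move=> P hP; have [eps Heps] := lim P hP.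
  by exists eps => q hq hI; rewrite LE //; exact: Heps.
have hD mu : Ck 1 (D mu) by apply: Ck_lin; apply: Ck_pd.
apply: continuous_Re_Im;
  apply: (continuous_lineR (U := prod_UniformSpace R_UniformSpace (fct_UniformSpace 'I_4 R_UniformSpace))
     (h := fun mu p z => _ (D mu (ext z p.1))) (p := fun p => p.2)) => [mu W f q w hf hq|q i].
- have /CkP[h _] := hD mu; apply: (continuous_comp_CkR h); apply: continuous_ext_arg => //.
  by apply: (continuous_comp f fst) => //; exact: continuous_fst.
- apply: (continuous_comp snd (fun y : fct_UniformSpace 'I_4 R_UniformSpace => y i)); [exact: continuous_snd | exact: continuous_eval].
- have /CkP[_ h] := hD mu; apply: (continuous_comp_CkR h); apply: continuous_ext_arg => //.
  by apply: (continuous_comp f fst) => //; exact: continuous_fst.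
- apply: (continuous_comp snd (fun y : fct_UniformSpace 'I_4 R_UniformSpace => y i)); [exact: continuous_snd | exact: continuous_eval].
Qed.

Lemma theta_admissible : admissible e FF theta.
Proof. split; [exact: theta_generates | exact: theta_continuous]. Qed.

End Gauges.

Local Notation "\csum_ ( i : t ) F" := (\big[Cplus/RtoC 0]_(i : t) F%C)
  (at level 41, F at level 41, i at level 50).
Local Notation "\csum_ ( i < n ) F" := (\big[Cplus/RtoC 0]_(i < n) F%C)
  (at level 41, F at level 41, i, n at level 50).
Local Notation "\cprod_ ( i < n ) F" := (\big[Cmult/RtoC 1]_(i < n) F%C)
  (at level 36, F at level 36, i, n at level 50).

(** * Operators on photon variables *)

Definition vlinear (V : vfield -> Prop) (l : vfield -> C) : Prop :=
  forall a b A B, V A -> V B -> l (lin a A b B) = (a * l A + b * l B)%C.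

Definition nfun (n : nat) := ('I_n -> M4) -> ('I_n -> 'I_4) -> C.

Definition tsum (I : finType) n (c : I -> C) (A : I -> 'I_n -> vfield) : nfun n :=
  fun y mu => \csum_(i : I) (c i * \cprod_(k < n) A i k (y k) (mu k)).

Section Tensors.
Variables (V : vfield -> Prop) (hV : vsubspace V).

Lemma vlinear_sum (I : finType) (d : I -> C) (B : I -> vfield) l :
  vlinear V l -> (forall i, V (B i)) ->
  V (fun z nu => \csum_(i : I) (d i * B i z nu)) /\
  l (fun z nu => \csum_(i : I) (d i * B i z nu)) = \csum_(i : I) (d i * l (B i)).
Proof.
move=> hl hB.
elim: (index_enum I) => [|i r [IH1 IH2]].
  have -> : (fun z nu => \big[Cplus/RtoC 0]_(i <- [::]) (d i * B i z nu)%C) = (fun _ _ => RtoC 0).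
    by apply: vfield_ext => z nu; rewrite big_nil.
  split; first exact: hV.1.
  rewrite big_nil; have := hl (RtoC 0) (RtoC 0) _ _ hV.1 hV.1.
  have -> : lin (RtoC 0) (fun _ _ => RtoC 0) (RtoC 0) (fun _ _ => RtoC 0) = (fun _ _ => RtoC 0).
    by apply: vfield_ext => z nu; rewrite /lin; ring.
  by move=> ->; ring.
have -> : (fun z nu => \big[Cplus/RtoC 0]_(j <- i :: r) (d j * B j z nu)%C)
   = lin (d i) (B i) (RtoC 1) (fun z nu => \big[Cplus/RtoC 0]_(j <- r) (d j * B j z nu)%C).
  by apply: vfield_ext => z nu; rewrite big_cons /lin; ring.
split; first exact: hV.2.
by rewrite hl // IH2 big_cons; ring.
Qed.

(** The variables are consumed one at a time, the last one first; on a sum of simple tensors the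
    outcome is a product of numbers, in which the order is immaterial. Commutation of operators on
    different variables is used in this form. *)
Lemma apply_all_tsum n (l : 'I_n -> vfield -> C) (I : finType) (c : I -> C) A :
  (forall k, vlinear V (l k)) -> (forall i k, V (A i k)) ->
  apply_all l (tsum c A) = \csum_(i : I) (c i * \cprod_(k < n) l k (A i k)).
Proof.
elim: n l c A => [|n IH] l c A hl hA /=.
  by apply: eq_bigr => i _; rewrite !big_ord0.
have -> : (fun y mu => l ord_max (fun z nu => tsum c A (ext y z) (ext mu nu)))
  = tsum (fun i => c i * l ord_max (A i ord_max))%C (fun i k => A i (lift ord_max k)).
  apply: functional_extensionality => y; apply: functional_extensionality => mu.
  have -> : (fun z nu => tsum c A (ext y z) (ext mu nu)) = (fun z nu => \csum_(i : I)
      ((c i * \cprod_(k < n) A i (lift ord_max k) (y k) (mu k)) * A i ord_max z nu)).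
    apply: vfield_ext => z nu; apply: eq_bigr => i _.
    rewrite (bigD1_ord ord_max) //= !ext_max.
    under eq_bigr => k _ do rewrite !ext_lift.
    by set p := \big[_/_]_(k < n) _; ring.
  rewrite (vlinear_sum _ (hl ord_max) (fun i => hA i ord_max)).2.
  by apply: eq_bigr => i _ /=; set p := \big[_/_]_(k < n) _; ring.
rewrite IH //; apply: eq_bigr => i _.
rewrite [in RHS](bigD1_ord ord_max) //=.
by set p := \big[_/_]_(k < n) _; ring.
Qed.

End Tensors.

(** The symmetry of [h] does not make the individual simple tensors symmetric. It yields a second
    representation of [h] with permuted factors, and comparing the two moves the permutation onto
    the functionals. *)
Lemma apply_all_perm (V : vfield -> Prop) (hV : vsubspace V) n (l : 'I_n -> vfield -> C)
    (I : finType) (c : I -> C) A (p : 'S_n) (h : nfun n) :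
  (forall k, vlinear V (l k)) -> (forall i k, V (A i k)) -> h = tsum c A ->
  (forall y mu, h (fun k => y (p k)) (fun k => mu (p k)) = h y mu) ->
  apply_all (fun k => l (p k)) h = apply_all l h.
Proof.
move=> hl hA hE hs.
have E : h = tsum c (fun i k => A i ((p^-1)%g k)).
  apply: functional_extensionality => y; apply: functional_extensionality => mu.
  rewrite -hs hE; apply: eq_bigr => i _; congr (_ * _)%C.
  rewrite (reindex_inj (@perm_inj _ p^-1)) /=.
  by apply: eq_bigr => k _; rewrite permKV.
rewrite [in LHS]hE [in RHS]E !(apply_all_tsum hV) //.
apply: eq_bigr => i _; congr (_ * _)%C.
rewrite [in RHS](reindex_inj (@perm_inj _ p)) /=.
by apply: eq_bigr => k _; rewrite permK.
Qed.

Section PhotonOperators.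
Variables (e : R) (he : e <> 0) (FF : tensor -> Prop) (hFF : tsubspace FF) (g : gpath FF).

(** A domain shared by the operators of all times: it contains every gauge of the path and also the
    velocities, which need not lie in any of these gauges but have field tensor 0. *)
Definition Vdom (A : vfield) : Prop := vCk 1 A /\ FF (dext A).

Lemma vCk0 k : vCk k (fun _ _ => RtoC 0).
Proof.
have h : CkR k (fun _ : M4 => 0).
  elim: k => [|k IH]; split=> //; try (move=> x; exact: continuous_const).
  move=> i.
  split=> [x|]; first exact: ex_derive_const.
  have -> : pdR i (fun _ : M4 => 0) = (fun _ => 0) by
    apply: functional_extensionality => x; exact: Derive_const.
  exact: IH.
by move=> mu; apply/CkP.
Qed.

Lemma Vdom_sub : vsubspace Vdom.
Proof.
split; first by split; [exact: vCk0 | rewrite dext0; exact: hFF.1].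
move=> a b A B [cA fA] [cB fB]; split; first exact: vCk_lin.
by rewrite dext_lin //; apply: FF_tlin.
Qed.

Lemma gauge_Vdom s A : I01 s -> gpos g s A -> Vdom A.
Proof.
move=> hs hA; have hG := gpos_gauge g hs.
by split; [exact: (gauge_vCk hG hA) | exact: (gauge_to hG hA)].
Qed.

Lemma gvel_Vdom s F : I01 s -> FF F -> Vdom (gvel g s F).
Proof.
by move=> hs hF; split; [exact: gvel_vCk | rewrite dext_gvel //; exact: hFF.1].
Qed.

Lemma theta_vlinear s z : I01 s ->
  vlinear (gpos g s) (fun A => theta e (gpos g s) (gvel g s) A z).
Proof.
move=> hs a b A B hA hB.
have [H _] := theta_generates hFF he (ex_intro _ g (ex_intro _ s (And3 hs erefl erefl))).
exact: H.
Qed.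

Lemma dinv_vlinear s A B a b : I01 s -> Vdom A -> Vdom B ->
  dinv (gpos g s) (dext (lin a A b B)) = lin a (dinv (gpos g s) (dext A)) b (dinv (gpos g s) (dext B)).
Proof.
by move=> hs [cA fA] [cB fB]; rewrite dext_lin // (dinv_lin (gpos_gauge g hs)).
Qed.

Lemma phop_vlinear kind t z : I01 t -> vlinear Vdom (phop (theta e) g kind t z).
Proof.
move=> ht a b A B hA hB; rewrite /phop dinv_vlinear //.
case: kind => [nu //|]; apply: theta_vlinear => //.
  exact: (dinv_spec (gpos_gauge g ht) hA.2).1.
exact: (dinv_spec (gpos_gauge g ht) hB.2).1.
Qed.

Lemma phop_closed kind t z A : I01 t -> dext A = (fun _ _ _ => RtoC 0) ->
  phop (theta e) g kind t z A = RtoC 0.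
Proof.
move=> ht h0; rewrite /phop h0 (dinv0 (gpos_gauge g ht)).
case: kind => [//|]; have hG := gpos_gauge g ht.
have := theta_vlinear z ht (RtoC 0) (RtoC 0) (gauge_sub hG).1 (gauge_sub hG).1.
have -> : lin (RtoC 0) (fun _ _ => RtoC 0) (RtoC 0) (fun _ _ => RtoC 0) = (fun _ _ => RtoC 0).
  by apply: vfield_ext => x nu; rewrite /lin; ring.
by move=> ->; ring.
Qed.

Lemma phop_gauge kind t z A : I01 t -> gpos g t A ->
  phop (theta e) g kind t z A =
  if kind is Some nu then A z nu else theta e (gpos g t) (gvel g t) A z.
Proof. by move=> ht hA; rewrite /phop (dinv_dext (gpos_gauge g ht)). Qed.

(* The integral of the scalars [theta] from time 0 to [s], see [gshift_deriv]. *)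
Definition gshift (s : R) (z : M4) (A : vfield) : C :=
  (- RtoC e * (line (dinv (gpos g s) (dext A)) z - line (dinv (gpos g 0%R) (dext A)) z))%C.

Lemma I01_0 : I01 0. Proof. lra. Qed.
Lemma I01_1 : I01 1. Proof. lra. Qed.

Lemma gshift_vlinear s z : I01 s -> vlinear Vdom (gshift s z).
Proof.
move=> hs a b A B hA hB; rewrite /gshift !dinv_vlinear //; try exact: I01_0.
have c t D : I01 t -> Vdom D -> vCk 0 (dinv (gpos g t) (dext D)).
  move=> ht [_ hD] mu; apply: Ck_le.
  exact: (gauge_vCk (gpos_gauge g ht) (dinv_spec (gpos_gauge g ht) hD).1).
rewrite !line_lin; try (by apply: c => //; exact: I01_0); by ring.
Qed.

Lemma gshift0 z A : gshift 0 z A = RtoC 0.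
Proof. by rewrite /gshift; ring. Qed.

Lemma gshift_deriv s z A : I01 s -> Vdom A ->
  dC (fun u => gshift u z A) s (phop (theta e) g None s z A).
Proof.
move=> hs [_ hF]; have [H [h2 hd hv]] := gpos_field g hF.
have hc : vCk 0 (gvel g s (dext A)) by move=> mu; apply: Ck_le; apply: gvel_vCk.
have D := dC_line z s (fun mu => Ck_le (h2 mu)).
rewrite -hv // in D.
have := dC_scal (- RtoC e)%C (dC_minus D (dC_const (line (dinv (gpos g 0%R) (dext A)) z) s)).
have -> : (- RtoC e * (line (gvel g s (dext A)) z - RtoC 0))%C = phop (theta e) g None s z A.
  have E := (dinv_spec (gpos_gauge g hs) hF).2.
  by rewrite /phop thetaE ?E //; ring.
by move=> D2; apply: dC_ext hs _ D2 => u hu; rewrite /gshift (hd u hu).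
Qed.

Section Rhs.
Variables (m : nat) (x : 'I_m -> M4) (sp : 'I_m -> 'I_4).
Variables (s : R) (hs : I01 s) (f : liftfun).
Arguments f : clear implicits.

Definition in_gauge (G : vfield -> Prop) (F : forall n, nfun n) : Prop :=
  forall n, exists (N : nat) (c : 'I_N -> C) (A : 'I_N -> 'I_n -> vfield),
    (forall i k, G (A i k)) /\ F n = tsum c A.

Hypothesis hf : in_gauge (gpos g s) (fun n => f m n x sp).

(** Written as a sum of simple tensors, the right-hand side is accessible to [apply_all_tsum]. The
    gradient term takes this form by exchanging the gradient of [Theta] for the velocity in slot
    [k], the coupling term by evaluating the last factor. The representation in sector [n.+1] is
    returned too, so that both sides of [apply_all_gauge_rhs] are computed from the same tensors. *)
Lemma gauge_rhs_tsum n :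
  exists (N0 N1 : nat) (c0 : 'I_N0 -> C) (c1 : 'I_N1 -> C)
    (A0 : 'I_N0 -> 'I_n -> vfield) (A1 : 'I_N1 -> 'I_n.+1 -> vfield),
  [/\ forall i k, gpos g s (A0 i k), forall i k, gpos g s (A1 i k),
     f m n.+1 x sp = tsum c1 A1 &
   gauge_rhs e (theta e (gpos g s) (gvel g s)) f m n x sp
   = tsum (I := ('I_n * 'I_N0 + 'I_m * 'I_N1)%type)
      (fun q => match q with
         | inl ki => c0 ki.2
         | inr ji => (Ci * RtoC (sqrt (INR n.+1)) *
             (c1 ji.2 * theta e (gpos g s) (gvel g s) (A1 ji.2 ord_max) (x ji.1)))%C
         end)
      (fun q => match q with
         | inl ki => upd (A0 ki.2) ki.1 (gvel g s (dext (A0 ki.2 ki.1)))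
         | inr ji => fun k => A1 ji.2 (lift ord_max k)
         end)].
Proof.
have [N0 [c0 [A0 [hA0 E0]]]] := hf n; have [N1 [c1 [A1 [hA1 E1]]]] := hf n.+1.
have hG := gpos_gauge g hs.
exists N0, N1, c0, c1, A0, A1; split=> //.
apply: functional_extensionality => y; apply: functional_extensionality => mu.
rewrite /gauge_rhs /tsum big_sumType /=; congr (_ + _)%C.
  rewrite big_distrr -(pair_bigA _ (fun k i => c0 i * \cprod_(k' < n)
     upd (A0 i) k (gvel g s (dext (A0 i k))) k' (y k') (mu k'))%C) /=.
  apply: eq_bigr => k _.
  pose d i := (c0 i * \big[Cmult/RtoC 1]_(k' < n | k' != k) A0 i k' (y k') (mu k'))%C.
  have -> : (fun z nu => f m n x sp (upd y k z) (upd mu k nu)) = (fun z nu => \csum_(i < N0) (d i * A0 i k z nu)).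
    apply: vfield_ext => z nu; rewrite E0; apply: eq_bigr => i _.
    rewrite (bigD1 k) //= !upd_same /d.
    have -> : \big[Cmult/RtoC 1]_(k' < n | k' != k) A0 i k' (upd y k z k') (upd mu k nu k')
       = \big[Cmult/RtoC 1]_(k' < n | k' != k) A0 i k' (y k') (mu k').
      by apply: eq_bigr => k' nk; rewrite /upd (negbTE nk).
    by set p := \big[_/_]_(k' < n | _) _; ring.
  have Tlin : vlinear (gpos g s) (fun A => gvel g s (dext A) (y k) (mu k)).
    move=> a b A B hA hB; rewrite dext_lin; try exact: (gauge_vCk hG).
    by rewrite gvel_lin //; exact: (gauge_to hG).
  have [hS ES] := vlinear_sum (gauge_sub hG) d Tlin (fun i => hA0 i k).
  have [_ gen] := theta_generates hFF he (ex_intro _ g (ex_intro _ s (And3 hs erefl erefl))).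
  (* The generating identity holds for members of the gauge, so it is applied to the whole field,
     and linearity of the velocity splits the sum. *)
  transitivity (\csum_(i < N0) (d i * gvel g s (dext (A0 i k)) (y k) (mu k))).
    by rewrite -ES -((gen _ hS).2 (y k) (mu k)) /=; ring.
  apply: eq_bigr => i _; rewrite [in RHS](bigD1 k) //= upd_same /d.
  have -> : \big[Cmult/RtoC 1]_(k' < n | k' != k) upd (A0 i) k (gvel g s (dext (A0 i k))) k' (y k') (mu k')
    = \big[Cmult/RtoC 1]_(k' < n | k' != k) A0 i k' (y k') (mu k').
    by apply: eq_bigr => k' nk; rewrite /upd (negbTE nk).
  by set p := \big[_/_]_(k' < n | _) _; ring.
rewrite big_distrr -(pair_bigA _ (fun j i => Ci * RtoC (sqrt (INR n.+1)) *
    (c1 i * theta e (gpos g s) (gvel g s) (A1 i ord_max) (x j)) * 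
    \cprod_(k < n) A1 i (lift ord_max k) (y k) (mu k))%C) /=.
apply: eq_bigr => j _.
have -> : (fun z nu => f m n.+1 x sp (ext y z) (ext mu nu)) = (fun z nu => \csum_(i < N1)
    ((c1 i * \cprod_(k < n) A1 i (lift ord_max k) (y k) (mu k)) * A1 i ord_max z nu)).
  apply: vfield_ext => z nu; rewrite E1; apply: eq_bigr => i _.
  rewrite (bigD1_ord ord_max) //= !ext_max.
  under eq_bigr => k _ do rewrite !ext_lift.
  by set p := \big[_/_]_(k < n) _; ring.
rewrite (vlinear_sum (gauge_sub hG) _ (theta_vlinear (x j) hs) (fun i => hA1 i ord_max)).2.
rewrite big_distrr; apply: eq_bigr => i _ /=.
by set p := \big[_/_]_(k < n) _; ring.
Qed.

(* The gradient terms drop out, since photon operators depend on the field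
   tensor only. *)
Lemma apply_all_gauge_rhs n (l : 'I_n -> vfield -> C) :
  (forall k, vlinear Vdom (l k)) ->
  (forall k A, dext A = (fun _ _ _ => RtoC 0) -> l k A = RtoC 0) ->
  apply_all l (gauge_rhs e (theta e (gpos g s) (gvel g s)) f m n x sp) =
  (Ci * RtoC (sqrt (INR n.+1)) *
   \csum_(j < m) apply_all (ext l (phop (theta e) g None s (x j))) (f m n.+1 x sp))%C.
Proof.
move=> hl hl0.
have [N0 [N1 [c0 [c1 [A0 [A1 [hA0 hA1 E1 ->]]]]]]] := gauge_rhs_tsum n.
have hA0V i k := gauge_Vdom hs (hA0 i k); have hA1V i k := gauge_Vdom hs (hA1 i k).
have W j : apply_all (ext l (phop (theta e) g None s (x j))) (f m n.+1 x sp) =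
    \csum_(i < N1) (c1 i * (\cprod_(k < n) l k (A1 i (lift ord_max k)) *
                     theta e (gpos g s) (gvel g s) (A1 i ord_max) (x j))).
  rewrite E1 (apply_all_tsum Vdom_sub) //; last first.
    move=> k; rewrite /ext; case: unlift => [k' //|]; exact: phop_vlinear.
  apply: eq_bigr => i _; rewrite (bigD1_ord ord_max) //= ext_max phop_gauge // Cmult_comm.
  under eq_bigr => k _ do rewrite ext_lift.
  by set p := \big[_/_]_(k < n) _; ring.
under [in RHS]eq_bigr => j _ do rewrite W.
rewrite (apply_all_tsum Vdom_sub) //; last first.
  move=> [[k i]|[j i]] k' //=; rewrite /upd; case: eqP => _ //.
  by apply: gvel_Vdom => //; case: (hA0V i k).
rewrite big_sumType /= big1 ?Cplus_0_l; last first.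
  move=> [k i] _ /=; rewrite (bigD1 k) //= upd_same hl0.
    by rewrite Cmult_0_l Cmult_0_r.
  by apply: dext_gvel => //; case: (hA0V i k).
rewrite -(pair_bigA _ (fun j i => Ci * RtoC (sqrt (INR n.+1)) *
    (c1 i * theta e (gpos g s) (gvel g s) (A1 i ord_max) (x j)) * 
    \cprod_(k < n) l k (A1 i (lift ord_max k)))%C) /= big_distrr.
apply: eq_bigr => j _ /=; rewrite big_distrr; apply: eq_bigr => i _ /=.
by set p := \big[_/_]_(k < n) _; ring.
Qed.

End Rhs.

End PhotonOperators.

(** * Repeated operators on symmetric photon functions *)

Lemma dC_prod n (F : 'I_n -> R -> C) (D : 'I_n -> C) s :
  (forall k, dC (F k) s (D k)) ->
  dC (fun u => \cprod_(k < n) F k u) s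
     (\csum_(k < n) \cprod_(k' < n) (if k' == k then D k else F k' s)).
Proof.
elim: n F D => [|n IH] F D H.
  by apply: dC_congr (dC_const (RtoC 1) s) => [u|]; rewrite big_ord0.
apply: dC_congr (dC_mult (IH _ _ (fun k => H (widen_ord (leqnSn n) k))) (H ord_max)).
  by move=> u; rewrite big_ord_recr.
rewrite big_ord_recr big_distrl /=; congr (_ + _)%C.
  apply: eq_bigr => k _; rewrite big_ord_recr /=; congr (_ * _)%C.
  by rewrite -val_eqE /= eq_sym (ltn_eqF (ltn_ord k)).
rewrite big_ord_recr /= eqxx; congr (_ * _)%C; apply: eq_bigr => k _.
by rewrite -val_eqE /= (ltn_eqF (ltn_ord k)).
Qed.

(** In [slots_deriv] the occupied slots are constant in time and every free slot contributes the
    same term; the truncated subtraction also covers the case without free slots. *)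
Lemma csum_tail n N (X : C) :
  \csum_(k < n) (if (k < N)%nat then RtoC 0 else X) = (RtoC (INR (n - N)) * X)%C.
Proof.
elim: n => [|n IH]; first by rewrite big_ord0 sub0n /=; ring.
rewrite big_ord_recr IH /=; case: (ltnP n N) => h.
  by rewrite (eqP (ltnW h : (n - N)%nat == 0%nat)) (eqP (h : (n.+1 - N)%nat == 0%nat)); ring.
by rewrite subSn // S_INR RtoC_plus; ring.
Qed.

Section Slots.
Variables (V : vfield -> Prop) (hV : vsubspace V) (F : forall n, nfun n) (hF : in_gauge V F).
Arguments F : clear implicits.
Implicit Types (L : seq (vfield -> C)) (lam : vfield -> C).

(* The default value [lam] of [nth] acts on the photon variables after those
   served by [L]. *)
Definition slots n L lam : C := apply_all (fun k : 'I_n => nth lam L k) (F n).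

Definition all_vlinear L := forall lam, vlinear V lam -> forall k, vlinear V (nth lam L k).

Lemma all_vlinear_rcons L l : all_vlinear L -> vlinear V l -> all_vlinear (rcons L l).
Proof.
by move=> hL hl lam hlam k; rewrite nth_rcons; case: ifP => _; [apply: hL | case: ifP].
Qed.

Lemma vlinear_csum (I : finType) (l : I -> vfield -> C) :
  (forall i, vlinear V (l i)) -> vlinear V (fun A => \csum_(i : I) l i A).
Proof.
move=> h a b A B hA hB; rewrite !big_distrr -big_split; apply: eq_bigr => i _.
exact: h.
Qed.

(** At time 0 the integrated operator vanishes, and one free slot is then enough to kill a term of
    the series. *)
Lemma slots0 n L : all_vlinear L -> (size L < n)%nat -> slots n L (fun=> RtoC 0) = RtoC 0.
Proof.
move=> hL hn; have [N [c [A [hA E]]]] := hF n.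
have h0 : vlinear V (fun=> RtoC 0) by move=> a b A' B _ _; ring.
rewrite /slots E (apply_all_tsum hV) //; last by move=> k; apply: hL.
rewrite big1 // => i _; rewrite (bigD1 (Ordinal hn)) //= nth_default //.
by rewrite Cmult_0_l Cmult_0_r.
Qed.

Lemma slots_csum n L (I : finType) (l : I -> vfield -> C) lam :
  all_vlinear L -> vlinear V lam -> (forall i, vlinear V (l i)) -> (size L < n)%nat ->
  slots n (rcons L (fun A => \csum_(i : I) l i A)) lam = \csum_(i : I) slots n (rcons L (l i)) lam.
Proof.
move=> hL hlam hl hn; have [N [c [A [hA E]]]] := hF n.
have W l' : vlinear V l' -> slots n (rcons L l') lam = \csum_(q < N)
    (l' (A q (Ordinal hn)) * (c q * \big[Cmult/RtoC 1]_(k < n | k != Ordinal hn) nth lam L k (A q k))).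
  move=> hl'; rewrite /slots E (apply_all_tsum hV) //; last first.
    by move=> k; apply: all_vlinear_rcons.
  apply: eq_bigr => q _; rewrite (bigD1 (Ordinal hn)) //= nth_rcons ltnn eqxx.
  have -> : \big[Cmult/RtoC 1]_(k < n | k != Ordinal hn) nth lam (rcons L l') k (A q k) =
            \big[Cmult/RtoC 1]_(k < n | k != Ordinal hn) nth lam L k (A q k).
    apply: eq_bigr => k nk; rewrite nth_rcons; case: ltngtP => // [h|h].
      by rewrite nth_default // ltnW.
    by case/eqP: nk; apply: val_inj.
  by set p := \big[_/_]_(k < n | _) _; ring.
rewrite W; last exact: vlinear_csum.
under [RHS]eq_bigr => i _ do rewrite W //.
by rewrite exchange_big /=; apply: eq_bigr => q _; rewrite big_distrl.
Qed.

Hypothesis F_sym : forall n (p : 'S_n) y mu,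
  F n (fun k => y (p k)) (fun k => mu (p k)) = F n y mu.

(** The product rule gives one term for each free slot. By the symmetry of [F] the differentiated
    functional may be moved to the first free slot, so all terms agree; their number later cancels
    against the factorial. This is where time ordering disappears. *)
Lemma slots_deriv n L (lam : R -> vfield -> C) (lam' : vfield -> C) s :
  all_vlinear L -> (forall u, I01 u -> vlinear V (lam u)) -> vlinear V lam' ->
  (forall A, V A -> dC (fun u => lam u A) s (lam' A)) -> I01 s ->
  dC (fun u => slots n L (lam u)) s
     (RtoC (INR (n - size L)) * slots n (rcons L lam') (lam s))%C.
Proof.
move=> hL hlam hlam' hD hs; have [N [c [A [hA E]]]] := hF n.
have hnth (u : R) : I01 u -> forall k, vlinear V (nth (lam u) L k).
  by move=> hu k; apply: hL; apply: hlam.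
pose D (i : 'I_N) (k : 'I_n) := if (k < size L)%nat then RtoC 0 else lam' (A i k).
have dD i (k : 'I_n) : dC (fun u => nth (lam u) L k (A i k)) s (D i k).
  rewrite /D; case: ltnP => h.
    apply: dC_congr (dC_const (nth (lam s) L k (A i k)) s) => // u.
    by rewrite (set_nth_default (lam u)).
  apply: dC_congr (hD _ (hA i k)) => // u; by rewrite nth_default.
have dS := dC_big (index_enum 'I_N) (fun i => dC_scal (c i) (dC_prod (dD i))).
have dS' : dC (fun u => slots n L (lam u)) s (\csum_(i < N) (c i *
    \csum_(k < n) \cprod_(k' < n) (if k' == k then D i k else nth (lam s) L k' (A i k')))).
  apply: dC_ext hs _ dS => u hu.
  by rewrite /slots E (apply_all_tsum hV) // => k; apply: hnth.
apply: dC_congr dS' => //.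
rewrite -csum_tail; under eq_bigr => i _ do rewrite big_distrr.
rewrite exchange_big /=; apply: eq_bigr => k _; case: ltnP => h.
  rewrite big1 // => i _; rewrite (bigD1 k) //= eqxx /D h.
  by rewrite Cmult_0_l Cmult_0_r.
have hn : (size L < n)%nat := leq_ltn_trans h (ltn_ord k).
transitivity (apply_all (upd (fun k' : 'I_n => nth (lam s) L k') k lam') (F n)).
  rewrite E (apply_all_tsum hV) //; last first.
    by move=> k'; rewrite /upd; case: eqP => _ //; apply: hnth.
  apply: eq_bigr => i _; congr (_ * _)%C; apply: eq_bigr => k' _.
  by rewrite /upd /D ltnNge h /=; case: eqP => [->|].
(* The transposition exchanges [k] with the first free slot [Ordinal hn], where [rcons] has put
   [lam']; the other free slots all carry [lam s]. *)
rewrite /slots -[in RHS](apply_all_perm hV (p := tperm (Ordinal hn) k) _ hA E (F_sym _)); last first.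
  by move=> k'; apply: all_vlinear_rcons => //; apply: hlam.
congr (apply_all _ _); apply: functional_extensionality => k'.
rewrite /upd nth_rcons; case: tpermP => [->|->|/eqP n1 /eqP n2] /=.
- case: eqP => [<-|nk] /=; first by rewrite ltnn eqxx.
  rewrite nth_default //= ltnNge h /=; case: ltngtP h => // h' _.
  by case: nk; apply: val_inj.
- by rewrite !eqxx ltnn.
- rewrite (negbTE n2); case: ltngtP => // h'; first by rewrite nth_default // ltnW.
  by case/eqP: n1; apply: val_inj.
Qed.

End Slots.

(** * Coefficients of the series *)

Definition rcoef (N K : nat) : R := sqrt (INR (N + K)`! / INR N`!) / INR K`!.

Lemma INR_fact_gt0 n : 0 < INR n`!.
Proof. by apply: lt_0_INR; apply/ltP; exact: fact_gt0. Qed.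

Lemma INR_factS n : INR n.+1`! = INR n.+1 * INR n`!.
Proof. by rewrite factS mult_INR. Qed.

(** The factor [K.+1] is the number of free slots from the product rule, the square root is the
    coupling to the next photon sector. Balancing the two, starting from [rcoef0], determines the
    coefficients. *)
Lemma rcoef_rec N K : rcoef N K.+1 * INR K.+1 = sqrt (INR N.+1) * rcoef N.+1 K.
Proof.
rewrite /rcoef; have h1 := INR_fact_gt0 K; have h2 := INR_fact_gt0 N.
have h3 := INR_fact_gt0 (N + K.+1).
have hN : 0 < INR N.+1 by apply: lt_0_INR; apply/ltP.
have hK : 0 < INR K.+1 by apply: lt_0_INR; apply/ltP.
have -> : INR (N + K.+1)`! / INR N`! = INR N.+1 * (INR (N.+1 + K)`! / INR N.+1`!).
  by rewrite addSnnS INR_factS; field; lra.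
rewrite sqrt_mult; [|lra|]; last first.
  apply: Rlt_le; apply: Rdiv_lt_0_compat; exact: INR_fact_gt0.
rewrite (INR_factS K); field; lra.
Qed.

Lemma rcoef0 N : rcoef N 0 = 1.
Proof.
have h := INR_fact_gt0 N; rewrite /rcoef addn0 Rdiv_diag ?sqrt_1 /=; lra.
Qed.

Definition ccoef (N K : nat) : C := (Cpow Ci K * RtoC (rcoef N K))%C.

Lemma ccoef_rec N K :
  (ccoef N K.+1 * RtoC (INR K.+1))%C = (Ci * RtoC (sqrt (INR N.+1)) * ccoef N.+1 K)%C.
Proof.
rewrite /ccoef -Cmult_assoc -RtoC_mult rcoef_rec RtoC_mult /=; ring.
Qed.

Lemma Cmod_csum n (F : 'I_n -> C) b : (forall i, Cmod (F i) <= b) ->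
  Cmod (\csum_(i < n) F i) <= INR n * b.
Proof.
move=> H; elim: n F H => [|n IH] F H; first by rewrite big_ord0 Cmod_0 /=; lra.
rewrite big_ord_recr S_INR /=; apply: Rle_trans (Cmod_triangle _ _) _.
apply: Rle_trans (Rplus_le_compat _ _ _ _ (IH _ (fun i => H (widen_ord (leqnSn n) i))) (H ord_max)) _; lra.
Qed.

(** * The iterated equation *)

Section Dyson.
Variables (e : R) (he : e <> 0) (FF : tensor -> Prop) (hFF : tsubspace FF) (g : gpath FF).
Variables (m : nat) (x : 'I_m -> M4).

Definition gshift_all (s : R) (A : vfield) : C := \csum_(j < m) gshift e g s (x j) A.

(** A partial sum of the series, for arbitrary functionals [L] on the first variables:
    differentiation lengthens [L], so the hierarchy does not close on the final components alone. *)
Definition dyson (F : forall n, nfun n) (N : nat) (s : R) (L : seq (vfield -> C)) : C :=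
  \csum_(K < N) (ccoef (size L) K * slots F (size L + K) L (gshift_all s)).

Section DysonDerivative.
Variables (F : forall n, nfun n) (hF : in_gauge (gpos g 0) F).
Arguments F : clear implicits.
Hypothesis F_sym : forall n (p : 'S_n) y mu,
  F n (fun k => y (p k)) (fun k => mu (p k)) = F n y mu.

Let V := @Vdom FF.

Lemma in_gauge_Vdom : in_gauge V F.
Proof.
move=> n; have [N [c [A [hA E]]]] := hF n; exists N, c, A; split=> // i k.
by apply: gauge_Vdom (hA i k); exact: I01_0.
Qed.

Lemma gshift_all_vlinear s : I01 s -> vlinear V (gshift_all s).
Proof. by move=> hs; apply: vlinear_csum => j; exact: gshift_vlinear. Qed.

Lemma gshift_all0 : gshift_all 0 = fun=> RtoC 0.
Proof.
apply: functional_extensionality => A; rewrite /gshift_all big1 // => j _.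
exact: gshift0.
Qed.

(** The term [K = 0] has no free slot and is constant; the term [K.+1] passes into the term [K] for
    a list longer by one. Hence the partial sums satisfy the hierarchy exactly, with one term fewer
    on the right. *)
Lemma dyson_deriv N s L : I01 s -> all_vlinear V L ->
  dC (fun u => dyson F N.+1 u L) s
     (Ci * RtoC (sqrt (INR (size L).+1)) *
      \csum_(j < m) dyson F N s (rcons L (phop (theta e) g None s (x j))))%C.
Proof.
move=> hs hL.
have hV := Vdom_sub hFF; have hFV := in_gauge_Vdom.
have hph j : vlinear V (phop (theta e) g None s (x j)) by exact: phop_vlinear.
have hD A : V A -> dC (fun u => gshift_all u A) s (\csum_(j < m) phop (theta e) g None s (x j) A).
  by move=> hA; apply: dC_big => j; apply: gshift_deriv.
have D (K : nat) := dC_scal (ccoef (size L) K) (slots_deriv hV hFV F_sym (size L + K) hL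
  gshift_all_vlinear (vlinear_csum hph) hD hs).
apply: dC_congr (dC_big (index_enum 'I_N.+1) (fun K => D K)) => //.
rewrite big_ord_recl /= addn0 subnn /=.
rewrite [X in (X + _)%C](_ : _ = RtoC 0); last by rewrite /=; ring.
rewrite Cplus_0_l big_distrr /dyson.
transitivity (\csum_(K < N) \csum_(j < m) (Ci * RtoC (sqrt (INR (size L).+1)) * (ccoef (size L).+1 K *
   slots F ((size L).+1 + K) (rcons L (phop (theta e) g None s (x j))) (gshift_all s)))).
  apply: eq_bigr => K _; rewrite -big_distrr.
  rewrite (_ : bump 0 K = K.+1) //.
  rewrite (addKn (size L) K.+1) (slots_csum hV hFV hL (gshift_all_vlinear hs) hph); last first.
    by rewrite addnS ltnS leq_addr.
  rewrite Cmult_assoc ccoef_rec addSnnS -Cmult_assoc; congr (_ * _)%C.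
  by rewrite big_distrr.
rewrite exchange_big; apply: eq_bigr => j _; rewrite size_rcons big_distrr.
by [].
Qed.

Lemma dyson_at0 N L : all_vlinear V L ->
  dyson F N.+1 0 L = slots F (size L) L (fun=> RtoC 0).
Proof.
move=> hL; rewrite /dyson big_ord_recl big1 => [|K _].
  rewrite /= addn0 gshift_all0 /ccoef rcoef0 /=; ring.
rewrite gshift_all0 (slots0 (Vdom_sub hFF) in_gauge_Vdom) //; first by ring.
by rewrite /= /bump /= add1n addnS ltnS leq_addr.
Qed.

End DysonDerivative.

Variables (sp : 'I_m -> 'I_4) (f : R -> liftfun).
Arguments f : clear implicits.
Hypothesis f_gauge : forall s, I01 s -> in_gauge (gpos g s) (fun n => f s m n x sp).
Hypothesis f_sym : forall n (p : 'S_n) y mu,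
  f 0 m n x sp (fun k => y (p k)) (fun k => mu (p k)) = f 0 m n x sp y mu.
Hypothesis f_deriv : forall n (kind : 'I_n -> option 'I_4) (z : 'I_n -> M4) (t : 'I_n -> R) s,
  (forall k, I01 (t k)) -> I01 s ->
  is_deriv01
    (fun u => apply_all (fun k => phop (theta e) g (kind k) (t k) (z k)) (f u m n x sp)) s
    (apply_all (fun k => phop (theta e) g (kind k) (t k) (z k))
       (gauge_rhs e (theta e (gpos g s) (gvel g s)) (f s) m n x sp)).

(* The arguments kind, time and position of [phop]. *)
Definition op : Type := option 'I_4 * R * M4.
Definition op0 : op := (None, 0, fun=> 0).
Definition op_fun (o : op) : vfield -> C := phop (theta e) g o.1.1 o.1.2 o.2.
(** The default [op0] carries the admissible time 0, so the condition may range over all [k]. *)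
Definition op_ok (ops : seq op) : Prop := forall k, I01 (nth op0 ops k).1.2.

(** Every variable is served, so the default 0 never acts; it matches the initial value in
    [dyson_at0]. Lists let the number of photons grow without casts between index types. *)
Definition evolved (s : R) (ops : seq op) : C :=
  slots (fun n => f s m n x sp) (size ops) (map op_fun ops) (fun=> RtoC 0).

Lemma op_ok_vlinear ops : op_ok ops -> all_vlinear (@Vdom FF) (map op_fun ops).
Proof.
move=> h lam hlam k; case: (ltnP k (size ops)) => hk.
  by rewrite (nth_map op0) //; apply: (phop_vlinear he hFF); exact: (h k).
by rewrite nth_default // size_map.
Qed.

Lemma op_ok_rcons ops o : op_ok ops -> I01 o.1.2 -> op_ok (rcons ops o).
Proof.
move=> h ho k; rewrite nth_rcons; case: ifP => _; first exact: (h k).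
by case: ifP => _ //; exact: I01_0.
Qed.

Lemma evolved_phop s ops : evolved s ops =
  apply_all (fun k : 'I_(size ops) => phop (theta e) g (nth op0 ops k).1.1 (nth op0 ops k).1.2 (nth op0 ops k).2)
    (f s m (size ops) x sp).
Proof.
congr (apply_all _ _); apply: functional_extensionality => k.
by rewrite (nth_map op0).
Qed.

(** The times recorded in [ops] stay fixed while the time of the wave function moves; the operator
    created by the coupling term records the current time [s]. *)
Lemma evolved_deriv s ops : I01 s -> op_ok ops ->
  dC (fun u => evolved u ops) s
     (Ci * RtoC (sqrt (INR (size ops).+1)) *
      \csum_(j < m) evolved s (rcons ops (None, s, x j)))%C.
Proof.
move=> hs hops.
have := is_deriv01_dC (f_deriv (fun k : 'I_(size ops) => (nth op0 ops k).1.1)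
  (fun k => (nth op0 ops k).2) (fun k => hops k) hs).
apply: dC_congr => [u|]; first by rewrite evolved_phop.
rewrite (apply_all_gauge_rhs he hFF hs (f_gauge hs)).
- congr (_ * _)%C; apply: eq_bigr => j _.
  rewrite evolved_phop size_rcons; congr (apply_all _ _).
  apply: functional_extensionality => k; rewrite nth_rcons.
  rewrite /ext; case: unliftP => [k' ->|->]; first by rewrite lift_max ltn_ord.
  by rewrite /= ltnn eqxx.
- by move=> k; apply: phop_vlinear.
- by move=> k A; apply: phop_closed.
Qed.

Notation F0 := (fun n => f 0 m n x sp).

Lemma dI_pow c N s : dI (fun u => c * u ^ N.+1) s (c * (INR N.+1 * s ^ N)).
Proof.
apply: dI_scal; apply: dI_of_derive; apply/is_derive_Reals.
exact: derivable_pt_lim_pow.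
Qed.

(* [evolved] and [dyson] satisfy the same hierarchy with the same initial values;
   [q] accumulates the factors of the steps already taken. *)
Lemma evolved_dyson_le N ops q eps : 0 <= eps -> op_ok ops -> 0 <= q ->
  (forall s (w : seq (R * 'I_m)), I01 s -> size w = N -> (forall k, I01 (nth 0 (unzip1 w) k)) ->
     q * (INR m ^ N * rcoef (size ops) N) *
     Cmod (evolved s (ops ++ [seq (None, p.1, x p.2) | p <- w])) <= eps) ->
  forall s, I01 s ->
  q * Cmod (evolved s ops - dyson F0 N s (map op_fun ops)) <= eps * s ^ N.
Proof.
move=> heps; elim: N ops q => [|N IH] ops q hops hq H s hs.
  (* With no terms in the sum and no further steps, the hypothesis for the empty list is the
     claim. *)
  have := H s [::] hs erefl (fun k => eq_ind_r I01 I01_0 (nth_nil 0 k)).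
  rewrite /dyson big_ord0 cats0 rcoef0 /= !Rmult_1_r.
  have -> // : (evolved s ops - 0)%C = evolved s ops by ring.
have hN : 0 < INR N.+1 by apply: lt_0_INR; apply/ltP.
have hS : 0 <= sqrt (INR (size ops).+1) by exact: sqrt_pos.
have hm : 0 <= INR m := pos_INR m.
(* The factors of one step: [INR m] from the sum over the electrons, the square root from the
   coupling, and division by [INR N.+1] from integrating [t ^ N]. *)
set q' := q * (INR m * sqrt (INR (size ops).+1)) / INR N.+1.
have hq' : 0 <= q'.
  apply: Rmult_le_pos; last by apply: Rlt_le; apply: Rinv_0_lt_compat.
  by apply: Rmult_le_pos => //; apply: Rmult_le_pos.
have step t : I01 t -> forall j, q' * Cmod (evolved t (rcons ops (None, t, x j)) -
     dyson F0 N t (map op_fun (rcons ops (None, t, x j)))) <= eps * t ^ N.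
  move=> ht j; apply: IH => //; first exact: op_ok_rcons.
  move=> s' w hs' hw hwI; rewrite size_rcons cat_rcons.
  (* The operator just appended to [ops] becomes the head of the list of further steps. *)
  have := H s' ((t, j) :: w) hs' (f_equal S hw).
  have -> : q' * (INR m ^ N * rcoef (size ops).+1 N) = q * (INR m ^ N.+1 * rcoef (size ops) N.+1).
    have E := rcoef_rec (size ops) N.
    have -> : rcoef (size ops) N.+1 = sqrt (INR (size ops).+1) * rcoef (size ops).+1 N / INR N.+1.
      by rewrite -E; field; lra.
    by rewrite /q' -tech_pow_Rmult; field; lra.
  by apply=> -[|k] //=; exact: (hwI k).
pose D t := (Ci * RtoC (sqrt (INR (size ops).+1)) *
      (\csum_(j < m) evolved t (rcons ops (None, t, x j)) -
       \csum_(j < m) dyson F0 N t (map op_fun (rcons ops (None, t, x j)))))%C.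
have hD t : I01 t -> dC (fun u => RtoC q * (evolved u ops - dyson F0 N.+1 u (map op_fun ops)))%C t (RtoC q * D t)%C.
  move=> ht; apply: dC_scal.
  have d2 := dyson_deriv (f_gauge I01_0) f_sym N ht (op_ok_vlinear hops).
  apply: dC_congr (dC_minus (evolved_deriv ht hops) d2) => //.
  rewrite size_map /D.
  set a := \big[_/_]_(j < m) _; set b := \big[_/_]_(j < m) _; set b' := \big[_/_]_(j < m) _.
  have -> : b' = b by rewrite /b' /b; apply: eq_bigr => j _; rewrite map_rcons.
  by ring.
have Q z : q * Cmod z = Cmod (RtoC q * z) by rewrite Cmod_mult Cmod_R Rabs_pos_eq.
rewrite Q.
apply: (Cmod_dC_le hD _ (g := fun u => eps * u ^ N.+1) (fun t _ => dI_pow eps N t)) => //.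
- rewrite dyson_at0; [|exact: f_gauge I01_0|exact: op_ok_vlinear].
  by rewrite /evolved size_map; ring.
- by rewrite /=; ring.
move=> t ht; rewrite -Q /D Cmod_mult Cmod_mult Cmod_R Rabs_pos_eq // Cmod_Ci Rmult_1_l.
have -> : (\csum_(j < m) evolved t (rcons ops (None, t, x j)) -
   \csum_(j < m) dyson F0 N t (map op_fun (rcons ops (None, t, x j))))%C =
   \csum_(j < m) (evolved t (rcons ops (None, t, x j)) - dyson F0 N t (map op_fun (rcons ops (None, t, x j)))).
  have E (a b : 'I_m -> C) : \csum_(j < m) (a j - b j) = (\csum_(j < m) a j - \csum_(j < m) b j)%C.
    rewrite big_split /=; congr (_ + _)%C.
    by apply: esym; apply: (big_morph Copp) => [u v|]; ring.
  by rewrite E.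
rewrite -Rmult_assoc.
have Q2 z : 0 <= z -> forall c, z * Cmod c = Cmod (RtoC z * c).
  by move=> hz c; rewrite Cmod_mult Cmod_R Rabs_pos_eq.
rewrite Q2; last exact: Rmult_le_pos.
rewrite big_distrr.
(* Without electrons the sum is empty; otherwise the bound is spread evenly over the [m] summands,
   which requires dividing by [m]. *)
case: (posnP m) => [m0|mpos].
  rewrite big1 => [|j]; last by have := ltn_ord j; rewrite {2}m0.
  rewrite Cmod_0; apply: Rmult_le_pos => //; apply: Rmult_le_pos; first exact: pos_INR.
  by apply: pow_le; case: ht.
have m0 : 0 < INR m by apply: lt_0_INR; apply/ltP.
have -> : eps * (INR N.+1 * t ^ N) = INR m * (eps * t ^ N * INR N.+1 / INR m) by field; lra.
apply: Cmod_csum => j; rewrite -Q2; last exact: Rmult_le_pos.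
have := step t ht j; set r := Cmod _ => hr.
have -> : q * sqrt (INR (size ops).+1) * r = q' * r * INR N.+1 / INR m.
  by rewrite /q'; field; lra.
apply: Rmult_le_compat_r; first by apply: Rlt_le; apply: Rinv_0_lt_compat.
by apply: Rmult_le_compat_r; lra.
Qed.

End Dyson.

(** * The final wave function as limit of the partial sums *)

Section Endpoint.
Variables (e : R) (he : e <> 0) (FF : tensor -> Prop) (hFF : tsubspace FF) (g : gpath FF).
Variables (rep : (vfield -> Prop) -> wavefun -> liftfun) (Psi : R -> wavefun).
Arguments rep : clear implicits.
Arguments Psi : clear implicits.
Hypothesis sol : solution e (theta e) rep g Psi.
Variables (m n : nat) (c : config m n) (sp : 'I_m -> 'I_4) (mu : 'I_n -> 'I_4).

Notation x := (epos c).
Notation y := (ppos c).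
Notation f := (fun s => rep (gpos g s) (Psi s)).

Lemma epos_spacelike : spacelike_el x.
Proof. by case: (config_spacelike c). Qed.

(** Read-out of the components in the gauge of time 1. On the wave function at time 1 it is plain
    evaluation; on the one at time 0 it includes the change of gauge. *)
Definition final_ops : seq op := [seq (Some (mu k), 1, y k) | k <- enum 'I_n].

Lemma nth_final_ops (k : 'I_n) : nth op0 final_ops k = (Some (mu k), 1, y k).
Proof. by rewrite (nth_map k) ?size_enum_ord // nth_ord_enum. Qed.

Lemma size_final_ops : size final_ops = n.
Proof. by rewrite size_map size_enum_ord. Qed.

Lemma final_ops_ok : op_ok final_ops.
Proof.
move=> k; case: (ltnP k n) => h; first by rewrite (nth_final_ops (Ordinal h)); exact: I01_1.
by rewrite nth_default ?size_final_ops //; exact: I01_0.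
Qed.

Lemma solution_in_gauge s : I01 s -> in_gauge (gpos g s) (fun n => f s m n x sp).
Proof.
move=> hs n'; have [N [c' [A [hA E]]]] := lift_gauge (sol_lift sol hs) n' epos_spacelike.
exists N, (fun i => c' i sp), A; split=> //.
by apply: functional_extensionality => z; apply: functional_extensionality => nu; rewrite E.
Qed.

Lemma evolved_final : evolved e g x sp f 1 final_ops = Psi 1 m n c sp mu.
Proof.
rewrite /evolved size_final_ops (lift_restr (sol_lift sol I01_1)).
have [N [c' [A [hA E]]]] := solution_in_gauge I01_1 n.
rewrite /slots E (apply_all_tsum (Vdom_sub hFF)); last first.
- by move=> i k; apply: gauge_Vdom (hA i k); exact: I01_1.
- move=> k; rewrite (nth_map op0) ?size_final_ops // nth_final_ops.
  by apply: (phop_vlinear he hFF); exact: I01_1.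
apply: eq_bigr => i _; congr (_ * _)%C; apply: eq_bigr => k _.
rewrite (nth_map op0) ?size_final_ops // nth_final_ops.
by rewrite /op_fun phop_gauge //; exact: I01_1.
Qed.

Lemma evolved_cat s (w : seq (R * 'I_m)) :
  evolved e g x sp f s (final_ops ++ [seq (None, p.1, x p.2) | p <- w]) =
  apply_all (cat_fun (fun k => phop (theta e) g (Some (mu k)) 1 (y k))
     (fun i => phop (theta e) g None (tnth (in_tuple w) i).1 (x (tnth (in_tuple w) i).2)))
    (f s m (n + size w)%nat x sp).
Proof.
rewrite /evolved size_cat size_final_ops size_map; congr (apply_all _ _).
apply: functional_extensionality => k; rewrite (nth_map op0); last first.
  by rewrite size_cat size_final_ops size_map.
rewrite nth_cat size_final_ops /cat_fun.
case: (split_ordP k) => i ->; rewrite ?(unsplitK (inl i)) ?(unsplitK (inr i)) /=.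
  by rewrite nth_final_ops.
rewrite addKn (tnth_nth (tnth (in_tuple w) i)).
by rewrite (nth_map (tnth (in_tuple w) i)).
Qed.

Lemma solution_dyson eps : 0 < eps -> exists N0, forall N, (N0 <= N)%nat ->
  Cmod (Psi 1 m n c sp mu -
        dyson e g x (fun n => f 0 m n x sp) N 1 (map (op_fun e g) final_ops)) <= eps.
Proof.
move=> heps.
have [N0 H] := sol_high sol sp y mu epos_spacelike I01_1 heps.
exists N0 => N hN; rewrite -evolved_final.
(* The accumulated weight [q] starts at 1, and the power of the time in the bound is 1 at time 1. *)
suff: 1 * Cmod (evolved e g x sp f 1 final_ops - dyson e g x (fun n => f 0 m n x sp) N 1 (map (op_fun e g) final_ops)) <= eps * 1 ^ N.
  by rewrite pow1 Rmult_1_l Rmult_1_r.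
apply: (evolved_dyson_le he hFF solution_in_gauge _ _ (Rlt_le _ _ heps) final_ops_ok Rle_0_1 _ I01_1).
- move=> n' p z nu; exact: (lift_sym (sol_lift sol I01_0) epos_spacelike).
- move=> n' kind z t s ht hs.
  exact: (sol_interchange (sol_smooth sol) _ _ _ epos_spacelike).
- move=> s w hs hw hwI; subst N.
  rewrite evolved_cat size_final_ops Rmult_1_l /rcoef /Rdiv -Rmult_assoc.
  apply: H => // i.
  have E (p0 : R * 'I_m) : nth 0 (unzip1 w) i = (tnth (in_tuple w) i).1.
    by rewrite (tnth_nth p0) (nth_map p0).
  by rewrite -(E (tnth (in_tuple w) i)); exact: hwI.
Qed.

End Endpoint.

Theorem proposition3 (e : R) (he : e <> 0%R)
    (FF : tensor -> Prop) (hFF : tsubspace FF) :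
  exists Th : theta_choice,
    admissible e FF Th /\
    forall (rep : (vfield -> Prop) -> wavefun -> liftfun)
      (g g' : gpath FF)
      (h0 : gpos g 0%R = gpos g' 0%R) (h1 : gpos g 1%R = gpos g' 1%R)
      (Psi0 : wavefun) (Psi Psi' : R -> wavefun),
      solution e Th rep g Psi -> Psi 0%R = Psi0 ->
      solution e Th rep g' Psi' -> Psi' 0%R = Psi0 ->
      Psi 1%R = Psi' 1%R.
Proof.
exists (theta e); split; first exact: theta_admissible.
move=> rep g g' h0 h1 Psi0 Psi Psi' sol i0 sol' i0'.
apply: functional_extensionality_dep => m; apply: functional_extensionality_dep => n.
apply: functional_extensionality => c; apply: functional_extensionality => sp.
apply: functional_extensionality => mu.
have E N : dyson e g (epos c) (fun n => rep (gpos g 0) (Psi 0) m n (epos c) sp) N 1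
     (map (op_fun e g) (final_ops c mu)) =
   dyson e g' (epos c) (fun n => rep (gpos g' 0) (Psi' 0) m n (epos c) sp) N 1
     (map (op_fun e g') (final_ops c mu)).
  (* [rep] depends on the gauge and the wave function only, so both paths start from the same
     lift. *)
  rewrite i0 i0' h0 /dyson.
  (* These operators are of kind [Some]: they involve the gauge at time 1, but not the direction of
     the path there. *)
  have -> : map (op_fun e g) (final_ops c mu) = map (op_fun e g') (final_ops c mu).
    rewrite -!map_comp; apply: eq_map => k /=.
    by rewrite /op_fun /phop /= h1.
  have -> // : gshift_all e g (epos c) 1 = gshift_all e g' (epos c) 1.
  by rewrite /gshift_all /gshift h0 h1.
have Z : Cmod (Psi 1 m n c sp mu - Psi' 1 m n c sp mu) = 0.
  apply: Rle_antisym; last exact: Cmod_ge_0.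
  apply: le_epsilon => eps heps; rewrite Rplus_0_l.
  have h2 : 0 < eps / 2 by lra.
  have [N1 H1] := solution_dyson he hFF sol c sp mu h2.
  have [N2 H2] := solution_dyson he hFF sol' c sp mu h2.
  have := H1 _ (leq_maxl N1 N2); have := H2 _ (leq_maxr N1 N2).
  rewrite E; set d := dyson _ _ _ _ _ _ _ => k2 k1.
  have -> : (Psi 1 m n c sp mu - Psi' 1 m n c sp mu)%C =
     (Psi 1 m n c sp mu - d + - (Psi' 1 m n c sp mu - d))%C by ring.
  apply: Rle_trans (Cmod_triangle _ _) _; rewrite Cmod_opp; lra.
have := Cmod_eq_0 _ Z => Z'.
by rewrite -[RHS]Cplus_0_l -Z'; ring.
Qed.
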